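(* Let $Z=(Z_1,\dots,Z_p)$ be a Gaussian random vector with mean $\tilde\mu$ and covariance matrix $\tilde\Sigma$, let $Y=(e^{Z_1},\dots,e^{Z_p})$ be the associated log-normal vector, and let $X=Y-\mathbb{E}[Y]$. Set $\tilde\mu_*=\|\tilde\mu\|_2$ and $\tilde\sigma_*^2=\|\tilde\Sigma\|_{op}$. Then for every integer $r\ge1$, $$b_L(2r;X)\le K_{2r}\left(\frac\pi2\right)^{2r}\tilde\sigma_*^{2r}\exp\left(2r\tilde\mu_*+\tfrac12(2r\tilde\sigma_* )^2\right),$$ and $$b_{Q_2}(2;X)\le4\pi^2K_2\,\tilde\sigma_*^2\,p\,\exp\left(4\tilde\mu_*+8\tilde\sigma_*^2\right).$$ In particular, if $\tilde\mu_*$ and $\tilde\sigma_*^2$ are uniformly bounded, then $b_L(2r;X)=O(1)$ and $b_{Q_2}(2;X)=O(p)$.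
   Context: $K_r$ denotes the $r$-th (absolute) moment of the standard Gaussian distribution on $\mathbb{R}$. For a random vector $X$ in $\mathbb{R}^p$, $b_L(k;X)$ denotes the best upper bound on $\mathbb{E}|X^\top v|^k$ over deterministic unit vectors $v$, i.e. $\sup_{\|v\|=1}\mathbb{E}|X^\top v|^k$, and $b_{Q_2}(k;X)$ the best upper bound on $\mathbb{E}|X^\top MX-\mathbb{E}[X^\top MX]|^k$ over deterministic positive semidefinite matrices $M$ with $\|M\|_{op}\le1$, i.e. the corresponding supremum. $\|\cdot\|_{op}$ is the operator norm. *)

(* Defs.v *)
From mathcomp Require Import all_boot all_order all_algebra.
From mathcomp Require Import all_classical all_reals all_analysis.

Set Implicit Arguments.
Unset Strict Implicit.
Unset Printing Implicit Defensive.

Import Order.TTheory GRing.Theory Num.Theory.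

Local Open Scope classical_set_scope.
Local Open Scope ring_scope.

(* The norm that the library puts on matrices is the sup norm, hence this
   definition. *)
Definition norm2 (R : realType) (p : nat) (v : 'cV[R]_p) : R :=
  Num.sqrt (\sum_(i < p) v i 0 ^+ 2).

(* A supremum of a nonempty bounded set as soon as 0 < p. *)
Definition opnorm (R : realType) (p : nat) (A : 'M[R]_p) : R :=
  sup [set norm2 (A *m v) | v in [set v : 'cV[R]_p | norm2 v = 1]].

Definition quad_form (R : realType) (p : nat) (M : 'M[R]_p) (x : 'cV[R]_p) : R :=
  (x^T *m M *m x) 0 0.

Definition psd (R : realType) (p : nat) (M : 'M[R]_p) : Prop :=
  M^T = M /\ forall x : 'cV[R]_p, 0 <= quad_form M x.

(* normal_prob m 0 is not a Dirac mass in the library (it is the uniform law on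
   [0, 1]), so the degenerate case is handled separately. *)
Definition gaussian_law (R : realType) (m s : R) (A : set R) : \bar R :=
  if s == 0 then \d_m A else normal_prob m s A.

(* The covariance matrix may be singular. *)
Definition gaussian_vector (R : realType) (d : measure_display)
    (T : measurableType d) (P : probability T R) (p : nat)
    (Z : 'I_p -> {RV P >-> R}) : Prop :=
  forall a : 'cV[R]_p, exists m s : R,
    forall A : set R, measurable A ->
      P [set w | A (\sum_(i < p) a i 0 * Z i w)] = gaussian_law m s A.

Definition has_mean (R : realType) (d : measure_display)
    (T : measurableType d) (P : probability T R) (p : nat)
    (Z : 'I_p -> {RV P >-> R}) (mu : 'cV[R]_p) : Prop :=
  forall i, ('E_P[Z i] = (mu i 0)%:E)%E.

Definition has_covariance (R : realType) (d : measure_display)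
    (T : measurableType d) (P : probability T R) (p : nat)
    (Z : 'I_p -> {RV P >-> R}) (Sigma : 'M[R]_p) : Prop :=
  forall i j, covariance P (Z i) (Z j) = (Sigma i j)%:E.

Definition gaussian_with (R : realType) (d : measure_display)
    (T : measurableType d) (P : probability T R) (p : nat)
    (Z : 'I_p -> {RV P >-> R}) (mu : 'cV[R]_p) (Sigma : 'M[R]_p) : Prop :=
  [/\ gaussian_vector Z, has_mean Z mu & has_covariance Z Sigma].

Definition lognormal (R : realType) (d : measure_display)
    (T : measurableType d) (P : probability T R) (p : nat)
    (Z : 'I_p -> {RV P >-> R}) (w : T) : 'cV[R]_p :=
  \col_(i < p) expR (Z i w).

(* fine sends an infinite expectation to 0; log-normal variables, and quadratic
   forms in them, are integrable. *)
Definition mean_vec (R : realType) (d : measure_display)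
    (T : measurableType d) (P : probability T R) (p : nat)
    (Y : T -> 'cV[R]_p) : 'cV[R]_p :=
  \col_(i < p) fine ('E_P[fun w => (Y w i 0)%R])%E.

Definition centered (R : realType) (d : measure_display)
    (T : measurableType d) (P : probability T R) (p : nat)
    (Y : T -> 'cV[R]_p) (w : T) : 'cV[R]_p :=
  Y w - mean_vec P Y.

Definition gauss_moment (R : realType) (r : nat) : \bar R :=
  ('E_(@normal_prob R 0 1)[fun x : R => (`|x| ^+ r)%R])%E.

(* The suprema are taken in the extended reals, so that a finite upper bound on
   them also asserts their finiteness. *)
Definition b_L (R : realType) (d : measure_display)
    (T : measurableType d) (P : probability T R) (p : nat)
    (k : nat) (X : T -> 'cV[R]_p) : \bar R :=
  ereal_sup [set ('E_P[fun w => (`|((X w)^T *m v) 0 0| ^+ k)%R])%E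
            | v in [set v : 'cV[R]_p | norm2 v = 1]].

Definition b_Q2 (R : realType) (d : measure_display)
    (T : measurableType d) (P : probability T R) (p : nat)
    (k : nat) (X : T -> 'cV[R]_p) : \bar R :=
  ereal_sup [set ('E_P[fun w => (`|quad_form M (X w)
                 - fine ('E_P[fun w' => quad_form M (X w')])%E| ^+ k)%R])%E
            | M in [set M : 'M[R]_p | psd M /\ opnorm M <= 1]].

(* Main.v *)
Require Import Defs.
From mathcomp Require Import all_boot all_order all_algebra.
From mathcomp Require Import all_classical all_reals all_analysis.
From mathcomp Require Import measurable_realfun zify ring lra.

(** Both bounds come from Pisier's inequality: for [f] a function of a Gaussian
vector [Z] with covariance [Sigma], and [Z'] an independent centered copy,
[E |f Z - E f| ^ (2 r)] is at most
[(pi / 2) ^ (2 r) * E |grad f (Z) . Z'| ^ (2 r)]. Conditionally on [Z], the pairing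
is normal with variance [quad_form Sigma (grad f)], which is at most the operator
norm of [Sigma] times the squared Euclidean norm of the gradient; this gives the
Gaussian moment of order [2 r], the power of the operator norm, and a moment of the
gradient ([pisier], [pisier_opnorm]).

Only functions [f] that are finite combinations of exponentials of linear forms
occur, and this makes the proof of Pisier's inequality elementary. The rotation
[(cos t) G + (sin t) G'] of two independent centered copies carries [G] to [G'] as
[t] goes from [0] to [pi / 2]. It is cut into [n] equal steps. All steps have
the same moment of order [2 r], because the moments of combinations of
exponentials are explicit functions of the differences of the angles
([rot_moment]). The power mean inequality bounds the increment along the whole
rotation, which controls the central moments ([symmetrization]), by one step
multiplied by [n] ([rot_telescope]), and this rescaled step converges, up to a
sign, to [pi / 2] times the derivative ([rot_increment_cvg]).

For a linear form with unit coefficient vector [v], the gradient has coordinates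
[v_i Y_i], and Jensen's inequality leaves the moments of order [2 r] of the
log-normal coordinates ([linear_moment_le]). For a quadratic form the gradient has
coordinates [2 Y_i (M X)_i]. The mean of [(M X)_i ^ 2 Y_i ^ 2] is an explicit sum
over the entries of [Sigma] ([weighted_second_moment]); it is at most
[expR (4 * norm2 mu + 8 * s)], with [s] the operator norm of [Sigma], because the
entrywise exponential of a covariance is controlled by [s] alone
([exp_covariance_le], [exp_row_le]). Summing over the coordinates gives the
factor [p]. The two uniform bounds follow by monotonicity in [norm2 mu] and [s]. *)

Set Implicit Arguments.
Unset Strict Implicit.
Unset Printing Implicit Defensive.

Import Order.TTheory GRing.Theory Num.Theory.
Import numFieldNormedType.Exports.

Local Open Scope classical_set_scope.
Local Open Scope ring_scope.

(** * Taylor lower bounds for combinations of exponentials *)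

Section exponential_series.
Context {R : realType}.

Lemma cvg_sum (I : Type) (s : seq I) (u : I -> nat -> R) (l : I -> R) :
  (forall i, u i n @[n --> \oo] --> l i) ->
  (\sum_(i <- s) u i n) @[n --> \oo] --> \sum_(i <- s) l i.
Proof.
move=> ul; elim: s => [|i s ih].
  by rewrite big_nil; under eq_fun do rewrite big_nil; exact: cvg_cst.
by rewrite big_cons; under eq_fun do rewrite big_cons; exact: cvgD.
Qed.

Lemma cvg_expR_series (x : R) : series (exp_coeff x) n @[n --> \oo] --> expR x.
Proof. exact: is_cvg_series_exp_coeff. Qed.

(** The terms of order at least [m] only increase the partial sums of the
exponential series; the limit of the partial sums is the right-hand side. *)
Lemma taylor_le_expR_sum (I : finType) (c x : I -> R) (m : nat) :
  (forall k, (m <= k)%N -> 0 <= \sum_i c i * x i ^+ k) ->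
  \sum_(k < m) (\sum_i c i * x i ^+ k) / k`!%:R <= \sum_i c i * expR (x i).
Proof.
move=> h.
have cv : (\sum_i c i * series (exp_coeff (x i)) n) @[n --> \oo] -->
    \sum_i c i * expR (x i).
  apply: cvg_sum => i; apply: cvgM; [exact: cvg_cst|exact: cvg_expR_series].
rewrite -(cvg_lim (@Rhausdorff R) cv); apply: limr_ge.
  by apply/cvg_ex; eexists; exact: cv.
near=> n.
have mn : (m <= n)%N by near: n; exact: nbhs_infty_ge.
rewrite [leRHS](_ : _ = \sum_(k < n) (\sum_i c i * x i ^+ k) / k`!%:R).
  rewrite -!(big_mkord xpredT (fun k => (\sum_i c i * x i ^+ k) / k`!%:R)).
  rewrite [leRHS](big_cat_nat _ mn)//= lerDl big_nat sumr_ge0// => k /andP[mk _].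
  by rewrite divr_ge0// h.
rewrite /series/= -(big_mkord xpredT (fun k => (\sum_i c i * x i ^+ k) / k`!%:R)).
under eq_bigr do rewrite mulr_sumr.
rewrite exchange_big/=; apply: eq_bigr => k _; rewrite mulr_suml.
by apply: eq_bigr => i _; rewrite exp_coeffE/= -mulrA; congr (_ * _);
  rewrite mulrC.
Unshelve. all: by end_near. Qed.

Lemma taylor1_le_expR_sum (I : finType) (c x : I -> R) :
  (forall k, (0 < k)%N -> 0 <= \sum_i c i * x i ^+ k) ->
  \sum_i c i <= \sum_i c i * expR (x i).
Proof.
move=> h; apply: le_trans (taylor_le_expR_sum h).
rewrite big_ord_recr big_ord0/= add0r fact0 divr1.
by under [leRHS]eq_bigr do rewrite expr0 mulr1.
Qed.

Lemma taylor2_le_expR_sum (I : finType) (c x : I -> R) :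
  (forall k, (1 < k)%N -> 0 <= \sum_i c i * x i ^+ k) ->
  \sum_i c i + \sum_i c i * x i <= \sum_i c i * expR (x i).
Proof.
move=> h; apply: le_trans (taylor_le_expR_sum h).
rewrite !big_ord_recr big_ord0/= add0r fact0 (_ : 1`! = 1%N)// !divr1.
under [in leRHS]eq_bigr do rewrite expr0 mulr1.
by under [X in _ <= _ + X]eq_bigr do rewrite expr1.
Qed.

Lemma taylor3_le_expR_sum (I : finType) (c x : I -> R) :
  (forall k, (2 < k)%N -> 0 <= \sum_i c i * x i ^+ k) ->
  \sum_i c i + \sum_i c i * x i + (\sum_i c i * x i ^+ 2) / 2 <=
  \sum_i c i * expR (x i).
Proof.
move=> h; apply: le_trans (taylor_le_expR_sum h).
rewrite !big_ord_recr big_ord0/= add0r fact0 (_ : 1`! = 1%N)// (_ : 2`! = 2%N)//.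
rewrite !divr1.
under [X in _ <= X + _ + _]eq_bigr do rewrite expr0 mulr1.
by under [X in _ <= _ + X + _]eq_bigr do rewrite expr1.
Qed.

Lemma cosh_ge (y : R) : 2 + y ^+ 2 <= expR y + expR (- y).
Proof.
have := @taylor3_le_expR_sum bool (fun=> 1) (fun b => if b then y else - y).
rewrite !big_bool/= !mul1r sqrrN => h; apply: le_trans (h _); first by lra.
move=> k _; rewrite big_bool/= !mul1r exprNn.
have := @exprn_even_ge0 R k y; rewrite -signr_odd.
by case: (odd k) => /= yk; rewrite ?expr1 ?expr0; [lra|have := yk isT; lra].
Qed.

(** For [t] in the unit interval, the terms of order at least four of the series
of [2 cosh (t x)] are dominated by those of [2 t ^ 4 cosh x]. *)
Lemma cosh_le (t x : R) : 0 <= t <= 1 ->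
  expR (t * x) + expR (- t * x) <=
  2 + t ^+ 2 * x ^+ 2 + t ^+ 4 * (expR (1 * x) + expR (- 1 * x)).
Proof.
move=> /andP[t0 t1].
have := @taylor3_le_expR_sum (bool * bool)%type
  (fun b => if b.1 then t ^+ 4 else - 1)
  (fun b => (if b.1 then 1 else t) * (if b.2 then x else - x)).
have E (F : bool * bool -> R) : \sum_b F b =
    F (true, true) + F (true, false) + F (false, true) + F (false, false).
  rewrite (eq_bigr (fun b => F (b.1, b.2))); last by case.
  by rewrite -(pair_bigA _ (fun a b => F (a, b)))/= !big_bool/= !addrA.
rewrite !E/= => hT; suff /hT : forall k, (2 < k)%N -> 0 <= \sum_b
    (if b.1 then t ^+ 4 else - 1) *
    ((if b.1 then 1 else t) * (if b.2 then x else - x)) ^+ k.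
  rewrite !mul1r !mulN1r !mulrN !mulNr => h.
  have t4 : 0 <= t ^+ 4 by rewrite exprn_ge0.
  have x2 : 0 <= x ^+ 2 by rewrite sqr_ge0.
  have tx : 0 <= t ^+ 4 * x ^+ 2 by rewrite mulr_ge0.
  rewrite !sqrrN !exprMn in h; lra.
move=> k k2; rewrite E/= !mul1r !mulN1r mulrN (exprNn x) (exprNn (t * x)) exprMn.
have := @exprn_even_ge0 R k x; rewrite -signr_odd.
case ok: (odd k) => /= xk; rewrite ?expr1 ?expr0; first lra.
have tk : t ^+ k <= t ^+ 4.
  have k4 : (4 <= k)%N by case: k k2 ok {xk} => [|[|[|[|k]]]].
  by rewrite ler_wiXn2l.
by have := ler_wpM2r (xk isT) tk; lra.
Qed.

End exponential_series.

(** * Convexity of powers *)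

Section power_convexity.
Context {R : realType}.

(** In the induction step the two sides differ by
[m.+1 * c ^ m * (y - c) ^ 2]. *)
Lemma tangent_exprn_ge0 (m : nat) (c y : R) : 0 <= c -> 0 <= y ->
  c ^+ m.+1 + m.+1%:R * c ^+ m * (y - c) <= y ^+ m.+1.
Proof.
move=> c0 y0; elim: m => [|m ih].
  by rewrite !expr1 expr0 mulr1 mul1r subrKC.
have := ler_wpM2l y0 ih; rewrite -exprS; apply: le_trans.
have -> : m.+2%:R = m.+1%:R + 1 :> R by rewrite -natr1.
have h : 0 <= m.+1%:R * c ^+ m * (y - c) ^+ 2.
  by rewrite mulr_ge0 ?sqr_ge0// mulr_ge0 ?exprn_ge0.
rewrite -subr_ge0; apply: (le_trans h); rewrite le_eqVlt; apply/orP; left.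
by apply/eqP; rewrite !exprS; ring.
Qed.

(** Changing the signs of [c] and [y] makes [c] nonnegative, and replacing [y] by
its absolute value then raises the tangent, so that the case of nonnegative
arguments applies. *)
Lemma tangent_exprn_even (r : nat) (c y : R) : (0 < r)%N ->
  c ^+ (2 * r) + (2 * r)%:R * c ^+ (2 * r).-1 * (y - c) <= y ^+ (2 * r).
Proof.
case: r => // r _; have e2 : (2 * r.+1 = (2 * r).+2)%N by rewrite mulnS.
rewrite e2/=.
wlog c0 : c y / 0 <= c => [wl|].
  have [|c0] := leP 0 c; first exact: wl.
  have := wl (- c) (- y); rewrite oppr_ge0 ltW// => /(_ isT).
  have even z : (- z : R) ^+ (2 * r).+2 = z ^+ (2 * r).+2.
    by rewrite -e2 !exprM sqrrN.
  have odd z : (- z : R) ^+ (2 * r).+1 = - z ^+ (2 * r).+1.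
    by rewrite !exprS !exprM sqrrN mulNr.
  by rewrite !even odd -opprD !mulrN mulNr opprK.
apply: (@le_trans _ _ (`|y| ^+ (2 * r).+2)); last first.
  by rewrite -e2 !exprM real_normK// num_real.
apply: le_trans (tangent_exprn_ge0 (2 * r).+1 c0 (normr_ge0 y)).
rewrite lerD2l ler_wpM2l// ?mulr_ge0 ?exprn_ge0//.
by rewrite lerD2r ler_norm.
Qed.

(** Jensen's inequality for the uniform weights, in the form in which it bounds
a telescoping sum. *)
Lemma power_mean_even (r n : nat) (x : nat -> R) : (0 < r)%N -> (0 < n)%N ->
  (\sum_(k < n) x k) ^+ (2 * r) <=
  n%:R ^+ (2 * r) * (n%:R^-1 * \sum_(k < n) x k ^+ (2 * r)).
Proof.
move=> r0 n0; have n0' : n%:R != 0 :> R by rewrite pnatr_eq0 -lt0n.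
pose c := n%:R^-1 * \sum_(k < n) x k.
have -> : \sum_(k < n) x k = n%:R * c by rewrite mulrA divff// mul1r.
rewrite exprMn ler_wpM2l// ?exprn_ge0//.
rewrite -(ler_pM2l (_ : 0 < n%:R)) ?ltr0n// mulrA divff// mul1r.
have : \sum_(k < n) (c ^+ (2 * r) + (2 * r)%:R * c ^+ (2 * r).-1 * (x k - c)) <=
    \sum_(k < n) x k ^+ (2 * r).
  by apply: ler_sum => k _; exact: tangent_exprn_even.
apply: le_trans; rewrite big_split/= sumr_const card_ord -mulr_sumr sumrB.
rewrite sumr_const card_ord -[c *+ n]mulr_natl [X in _ - X]mulrA divff// mul1r.
by rewrite subrr mulr0 addr0 mulr_natl.
Qed.

(** Average the tangent inequality at the weighted mean: the linear terms
cancel. *)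
Lemma jensen_exprn (I : finType) (u x : I -> R) (m : nat) :
  (forall i, 0 <= u i) -> \sum_i u i = 1 -> (forall i, 0 <= x i) ->
  (\sum_i u i * x i) ^+ m.+1 <= \sum_i u i * x i ^+ m.+1.
Proof.
move=> u0 u1 x0; set c := \sum_i u i * x i.
have c0 : 0 <= c by apply: sumr_ge0 => i _; rewrite mulr_ge0.
have : \sum_i u i * (c ^+ m.+1 + m.+1%:R * c ^+ m * (x i - c)) <=
    \sum_i u i * x i ^+ m.+1.
  by apply: ler_sum => i _; rewrite ler_wpM2l// tangent_exprn_ge0.
apply: le_trans; under eq_bigr do rewrite mulrDr [u _ * (_ * (_ - _))]mulrCA mulrBr.
rewrite big_split/= -mulr_suml u1 mul1r -mulr_sumr sumrB -mulr_suml u1 mul1r.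
by rewrite subrr mulr0 addr0.
Qed.

End power_convexity.

(** * Functions of at most exponential growth *)

Section tame.
Context {R : realType} {d : measure_display} {T : measurableType d}
  {P : probability T R}.
Implicit Types (N F : T -> R).

(** A function all of whose exponential moments are finite; it measures the size
of the underlying Gaussian vector. The offset [1] makes constants bounded by a
multiple of [N + 1]. *)
Definition gauge (N : T -> R) := [/\ measurable_fun setT N,
  forall x, 0 <= N x &
  forall k : nat, P.-integrable setT (fun x => (expR (k%:R * (N x + 1)))%:E)].

(** A class of integrable functions that is stable under sums and products and
contains polynomials and exponentials of linear forms, so that integrability
follows from the shape of the integrand. A multiplicative constant is absorbed
in the offset of the exponent. *)
Definition tame (N F : T -> R) := measurable_fun setT F /\
  exists k : nat, forall x, `|F x| <= expR (k%:R * (N x + 1)).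

Definition lin_growth (N F : T -> R) := measurable_fun setT F /\
  exists k : nat, forall x, `|F x| <= k%:R * (N x + 1).

Variable N : T -> R.
Hypothesis gN : gauge N.

Lemma gauge_integrable F : tame N F -> P.-integrable setT (EFin \o F).
Proof.
case: gN => mN N0 iN [mF [k Fk]].
apply: le_integrable (iN k) => //; first exact/measurable_EFinP.
by move=> x _ /=; rewrite lee_fin (le_trans (Fk x))// ler_norm.
Qed.

Lemma lin_growth_tame F : lin_growth N F -> tame N F.
Proof.
move=> [mF [k Fk]]; split => //; exists k => x; apply: (le_trans (Fk x)).
by apply: le_trans (expR_ge1Dx _); rewrite lerDr.
Qed.

Lemma lin_growth_gauge : lin_growth N N.
Proof.
case: gN => mN N0 _; split => //; exists 1%N => x.
by rewrite mul1r ger0_norm// lerDl.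
Qed.

Lemma lin_growth_cst c : lin_growth N (cst c).
Proof.
case: gN => mN N0 _; split => //; exists (Num.truncn `|c|).+1 => x /=.
apply: (@le_trans _ _ (Num.truncn `|c|).+1%:R); first by rewrite ltW// truncnS_gt.
by rewrite ler_peMr// lerDr.
Qed.

Lemma lin_growthD F G : lin_growth N F -> lin_growth N G -> lin_growth N (F \+ G).
Proof.
move=> [mF [k Fk]] [mG [l Gl]]; split; first exact: measurable_funD.
exists (k + l)%N => x; rewrite natrD mulrDl (le_trans (ler_normD _ _))//.
exact: lerD.
Qed.

Lemma lin_growthZ c F : lin_growth N F -> lin_growth N (fun x => c * F x).
Proof.
move=> [mF [k Fk]]; split; first exact: measurable_funM.
have [_ [l cl]] := lin_growth_cst c.
case: gN => mN N0 _.
exists ((Num.truncn `|c|).+1 * k)%N => x; rewrite natrM -mulrA normrM ler_pM//.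
by rewrite ltW// truncnS_gt.
Qed.

Lemma lin_growth_sum (I : Type) (s : seq I) (F : I -> T -> R) :
  (forall i, lin_growth N (F i)) -> lin_growth N (fun x => \sum_(i <- s) F i x).
Proof.
move=> hF; elim: s => [|i s ih].
  under eq_fun do rewrite big_nil; exact: lin_growth_cst.
by under eq_fun do rewrite big_cons; exact: lin_growthD.
Qed.

Lemma tame_cst c : tame N (cst c).
Proof. exact/lin_growth_tame/lin_growth_cst. Qed.

Lemma tame_expR F : lin_growth N F -> tame N (fun x => expR (F x)).
Proof.
move=> [mF [k Fk]]; split; first exact: measurableT_comp.
exists k => x; rewrite ger0_norm ?expR_ge0// ler_expR.
exact: le_trans (ler_norm _) (Fk x).
Qed.

Lemma tameM F G : tame N F -> tame N G -> tame N (fun x => F x * G x).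
Proof.
move=> [mF [k Fk]] [mG [l Gl]]; split; first exact: measurable_funM.
by exists (k + l)%N => x; rewrite natrD mulrDl expRD normrM ler_pM.
Qed.

Lemma tameD F G : tame N F -> tame N G -> tame N (fun x => F x + G x).
Proof.
case: gN => mN N0 _ [mF [k Fk]] [mG [l Gl]]; split; first exact: measurable_funD.
exists (k + l + 1)%N => x.
have N1 : 0 <= N x + 1 by rewrite addr_ge0.
have e2 : 2 <= expR (N x + 1).
  by apply: le_trans (expR_ge1Dx _); have := N0 x; lra.
have h a b : expR (a%:R * (N x + 1)) <= expR ((a + b)%:R * (N x + 1)).
  by rewrite ler_expR ler_wpM2r// ler_nat leq_addr.
apply: (le_trans (ler_normD _ _)).
rewrite natrD [X in expR X]mulrDl expRD mul1r.
apply: (le_trans (lerD (Fk x) (Gl x))).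
apply: (@le_trans _ _ (expR ((k + l)%:R * (N x + 1)) * 2)); last first.
  by rewrite ler_wpM2l// expR_ge0.
by rewrite mulr_natr mulr2n lerD//; rewrite addnC.
Qed.

Lemma tameZ c F : tame N F -> tame N (fun x => c * F x).
Proof. by move=> tF; apply: tameM => //; exact: tame_cst. Qed.

Lemma tameN F : tame N F -> tame N (fun x => - F x).
Proof. by under [X in _ -> tame _ X]eq_fun do rewrite -mulN1r; exact: tameZ. Qed.

Lemma tameB F G : tame N F -> tame N G -> tame N (fun x => F x - G x).
Proof. by move=> tF /tameN; exact: tameD. Qed.

Lemma tameX n F : tame N F -> tame N (fun x => F x ^+ n).
Proof.
move=> tF; elim: n => [|n ih]; first exact: tame_cst.
by under eq_fun do rewrite exprS; exact: tameM.
Qed.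

Lemma tame_norm F : tame N F -> tame N (fun x => `|F x|).
Proof.
move=> [mF [k Fk]]; split; first exact: measurableT_comp.
by exists k => x; rewrite normr_id.
Qed.

Lemma tame_sum (I : Type) (s : seq I) (F : I -> T -> R) :
  (forall i, tame N (F i)) -> tame N (fun x => \sum_(i <- s) F i x).
Proof.
move=> hF; elim: s => [|i s ih].
  under eq_fun do rewrite big_nil; exact: tame_cst.
by under eq_fun do rewrite big_cons; exact: tameD.
Qed.

Lemma tame_integralE F : tame N F -> (\int[P]_x (F x)%:E = (\int[P]_x F x)%:E)%E.
Proof.
by move=> /gauge_integrable iF; rewrite /Rintegral fineK// integrable_fin_num.
Qed.

Lemma tame_RintegralD F G : tame N F -> tame N G ->
  \int[P]_x (F x + G x) = \int[P]_x F x + \int[P]_x G x.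
Proof. by move=> tF tG; apply: RintegralD => //; exact: gauge_integrable. Qed.

Lemma tame_RintegralZ c F : tame N F -> \int[P]_x (c * F x) = c * \int[P]_x F x.
Proof. by move=> tF; apply: RintegralZl => //; exact: gauge_integrable. Qed.

Lemma tame_RintegralB F G : tame N F -> tame N G ->
  \int[P]_x (F x - G x) = \int[P]_x F x - \int[P]_x G x.
Proof. by move=> tF tG; apply: RintegralB => //; exact: gauge_integrable. Qed.

Lemma Rintegral_prob_cst c : \int[P]_x c = c.
Proof.
by rewrite /Rintegral integral_cst// [X in (_ * X)%E]probability_setT mule1.
Qed.

Lemma tame_Rintegral_sum (I : Type) (s : seq I) (F : I -> T -> R) :
  (forall i, tame N (F i)) ->
  \int[P]_x (\sum_(i <- s) F i x) = \sum_(i <- s) \int[P]_x F i x.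
Proof.
move=> hF; elim: s => [|i s ih].
  by under eq_Rintegral do rewrite big_nil; rewrite Rintegral_prob_cst big_nil.
under eq_Rintegral do rewrite big_cons.
by rewrite big_cons tame_RintegralD//; [rewrite ih|exact: tame_sum].
Qed.

Lemma tame_le_Rintegral F G : tame N F -> tame N G -> (forall x, F x <= G x) ->
  \int[P]_x F x <= \int[P]_x G x.
Proof. by move=> tF tG h; apply: le_Rintegral => //; exact: gauge_integrable. Qed.

Lemma tame_cvg_Rintegral (F_ : nat -> T -> R) F G :
  (forall n, measurable_fun setT (F_ n)) -> tame N F -> tame N G ->
  (forall x, F_ n x @[n --> \oo] --> F x) ->
  (forall n x, `|F_ n x| <= G x) ->
  \int[P]_x F_ n x @[n --> \oo] --> \int[P]_x F x.
Proof.
move=> mF tF tG FF FG.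
have [_ _ h] := @dominated_convergence _ T R P setT measurableT
  (fun n x => (F_ n x)%:E) (EFin \o F) (EFin \o G)
  (fun n => (measurable_EFinP _ _).2 (mF n)) ((measurable_EFinP _ _).2 tF.1)
  ltac:(by apply: aeW => x _; apply: cvg_EFin; [exact: nearW|exact: FF])
  (gauge_integrable tG)
  ltac:(by apply: aeW => x n _ /=; rewrite lee_fin).
apply: fine_cvg.
by rewrite -tame_integralE.
Qed.

End tame.

Section jensen.
Context {R : realType} {d : measure_display} {T : measurableType d}
  {P : probability T R}.
Variable N : T -> R.
Hypothesis gN : gauge (P := P) N.

(** Integrate the tangent inequality at the mean. *)
Lemma jensen_exprn_even F (r : nat) : (0 < r)%N -> tame N F ->
  (\int[P]_x F x) ^+ (2 * r) <= \int[P]_x F x ^+ (2 * r).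
Proof.
move=> r0 tF; set c := \int[P]_x F x.
have t0 := tame_cst gN (c ^+ (2 * r)).
have t1 := tameB gN tF (tame_cst gN c).
have t2 := tameZ gN ((2 * r)%:R * c ^+ (2 * r).-1) t1.
have := tame_le_Rintegral gN (tameD gN t0 t2) (tameX gN (2 * r) tF)
  (fun x => tangent_exprn_even c (F x) r0).
rewrite (tame_RintegralD gN t0 t2) (tame_RintegralZ gN _ t1).
rewrite (tame_RintegralB gN tF (tame_cst gN c)).
by rewrite !Rintegral_prob_cst subrr mulr0 addr0.
Qed.

End jensen.

(** * The standard normal law *)

Section standard_normal.
Context {R : realType}.
Local Notation mu := (@lebesgue_measure R).
Local Notation gamma := (@normal_prob R 0 1).

(** The Radon-Nikodym derivative of [normal_prob m s] with respect to Lebesgue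
measure is almost everywhere its density, because both have the same integral
over every measurable set. *)
Lemma ge0_integral_normal (m s : R) (f : R -> R) :
  measurable_fun setT f -> (forall x, 0 <= f x) ->
  (\int[normal_prob m s]_x (f x)%:E =
   \int[mu]_x (f x * normal_pdf m s x)%:E)%E.
Proof.
move=> mf f0.
have dom : normal_prob m s `<< mu by exact: normal_prob_dominates.
rewrite -(Radon_Nikodym_SigmaFinite.change_of_variables dom)//=;
  last exact/measurable_EFinP.
apply: ae_eq_integral => //.
- apply: emeasurable_funM; first exact/measurable_EFinP.
  exact: measurable_int (Radon_Nikodym_SigmaFinite.f_integrable dom).
- by apply/measurable_EFinP/measurable_funM => //; exact: measurable_normal_pdf.
- under [X in ae_eq _ _ _ X]eq_fun do rewrite EFinM.
  apply: ae_eqe_mul2l => /=.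
  apply: integral_ae_eq => //=.
  + exact: Radon_Nikodym_SigmaFinite.f_integrable.
  + by apply/measurable_EFinP; exact: measurable_normal_pdf.
  + by move=> E _ mE; rewrite -Radon_Nikodym_SigmaFinite.f_integral.
Qed.

(** Completing the square turns [expR (t * x)] times the standard density into a
multiple of the density of the normal law of mean [t]. *)
Lemma normal_mgf (t : R) :
  (\int[gamma]_x (expR (t * x))%:E = (expR (t ^+ 2 / 2))%:E)%E.
Proof.
rewrite ge0_integral_normal; last 2 first.
- by apply: measurableT_comp => //; exact: measurable_funM.
- by move=> x; exact: expR_ge0.
under eq_integral => x _.
  rewrite (_ : _ * _ = expR (t ^+ 2 / 2) * normal_pdf t 1 x); last first.
    rewrite !normal_pdfE ?oner_eq0// mulrCA [in RHS]mulrCA; congr (_ * _).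
    rewrite /normal_fun -!expRD; congr expR; by field.
  rewrite EFinM; over.
rewrite ge0_integralZl//=.
- by rewrite integral_normal_pdf mule1.
- by apply/measurable_EFinP; exact: measurable_normal_pdf.
- by move=> x _; rewrite lee_fin normal_pdf_ge0.
Qed.

Lemma normal_prob_abs (m s : R) : normal_prob m s = normal_prob m `|s|.
Proof.
apply/funext => A; rewrite /normal_prob; apply: eq_integral => x _; congr _%:E.
rewrite /normal_pdf normr_eq0; case: ifP => // _.
by rewrite /normal_peak /normal_fun real_normK// num_real.
Qed.

Lemma ge0_integral_normal_affine (m s : R) (f : R -> R) : 0 < s ->
  continuous f -> (forall x, 0 <= f x) ->
  (\int[normal_prob m s]_x (f x)%:E = \int[gamma]_x (f (m + s * x)%R)%:E)%E.
Proof.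
move=> s0 cf f0.
have sn0 : s != 0 by rewrite gt_eqF.
pose F x : R := m + s * x.
have dF (x : R) : is_derive x 1 F s.
  rewrite /F; apply: is_derive_eq.
  by rewrite add0r mul1r; exact: mulr1.
have F'E : F^`()%classic = cst s.
  by apply/funext => x; rewrite derive1E; apply: derive_val.
have mf : measurable_fun setT f by exact: continuous_measurable_fun.
have mfF : measurable_fun setT (f \o F).
  apply: measurableT_comp; first exact: mf.
  by apply: measurable_funD => //; exact: measurable_funM.
rewrite (ge0_integral_normal m s mf f0).
rewrite (ge0_integral_normal 0 1 mfF (fun x => f0 (F x))).
rewrite (@increasing_ge0_integration_by_substitutionT _ F)//.
- apply: eq_integral => x _; congr _%:E; rewrite F'E /= !fctE /= /F -mulrA.
  congr (_ * _).
  rewrite !normal_pdfE ?oner_eq0// /normal_peak /normal_fun.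
  rewrite mulrAC; congr (_ * expR _); last by field.
  rewrite expr1n mul1r -mulrnAr sqrtrM ?sqr_ge0// sqrtr_sqr gtr0_norm//.
  rewrite invfM mulrAC mulVf ?mul1r//.
- by move=> x y xy; rewrite /F ltrD2l ltr_pM2l.
- by rewrite F'E => ?; exact: cvg_cst.
- by rewrite F'E; exact: is_cvg_cst.
- by rewrite F'E; exact: is_cvg_cst.
- apply: (cvg_comp (fun x => s * x) (fun x => m + x)).
    exact: gt0_cvgMrNy.
  by have := cvg_addrl_Ny m; apply: cvg_trans.
- apply: (cvg_comp (fun x => s * x) (fun x => m + x)).
    exact: gt0_cvgMry.
  by have := cvg_addrl m; apply: cvg_trans.
- move=> x; apply: continuousM; first exact: cf.
  exact: continuous_normal_pdf.
- by move=> x; rewrite mulr_ge0// normal_pdf_ge0.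
Qed.

End standard_normal.

Section standard_normal_moments.
Context {R : realType}.
Local Notation gamma := (@normal_prob R 0 1).
Local Notation tameR := (@tame R _ (measurableTypeR R) (fun x => `|x|)).

Lemma expR_norm_le (k x : R) :
  expR (k * `|x|) <= expR (k * x) + expR (- k * x).
Proof.
case: ger0P => _; first by rewrite lerDl expR_ge0.
by rewrite mulrN mulNr lerDr expR_ge0.
Qed.

(** [expR (k * |x|) <= expR (k * x) + expR (- k * x)], and the two terms on the
right have finite integrals. *)
Lemma gauge_normal : gauge (P := gamma) (fun x : R => `|x|).
Proof.
split; [exact: normr_measurable|by []|move=> k].
have ie (t : R) : gamma.-integrable setT (fun x => (expR (t * x))%:E).
  apply/integrableP; split.
    apply/measurable_EFinP/measurableT_comp => //; exact: measurable_funM.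
  under eq_integral do rewrite /= ger0_norm ?expR_ge0//.
  by rewrite normal_mgf ltry.
have := integrableZl measurableT (expR k%:R)
  (integrableD measurableT (ie k%:R) (ie (- k%:R))).
apply: le_integrable => //=.
  apply/measurable_EFinP/measurableT_comp => //; apply: measurable_funM => //.
  by apply: measurable_funD => //; exact: normr_measurable.
move=> x _; rewrite lee_fin (le_trans _ (ler_norm _))//.
rewrite (ger0_norm (expR_ge0 _)).
rewrite mulrDr mulr1 expRD mulrC ler_wpM2l ?expR_ge0//.
exact: expR_norm_le.
Qed.

Lemma lin_growth_id : @lin_growth R _ (measurableTypeR R) (fun x => `|x|) id.
Proof. by split => //; exists 1%N => x; rewrite mul1r lerDl. Qed.

Lemma tame_id : tameR id.
Proof. apply: lin_growth_tame; exact: lin_growth_id. Qed.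

Lemma tame_exp_line (t : R) : tameR (fun x => expR (t * x)).
Proof.
apply: tame_expR; apply: (lin_growthZ gauge_normal).
exact: lin_growth_id.
Qed.

Lemma normal_Rmgf (t : R) : \int[gamma]_x expR (t * x) = expR (t ^+ 2 / 2).
Proof. by rewrite /Rintegral normal_mgf. Qed.

(** [1 + t x <= expR (t x)] integrates to [t E x <= expR (t ^ 2 / 2) - 1] for
every real [t], which forces [E x = 0] as [t] tends to [0] from either side. *)
Lemma normal_mean : \int[gamma]_x x = 0.
Proof.
set m := (X in X = _).
have h t : 1 + t * m <= expR (t ^+ 2 / 2).
  have t1 : tameR (cst (1:R)) by exact: (tame_cst gauge_normal).
  have tt : tameR (fun x => t * x).
    by apply: (tameZ gauge_normal); exact: tame_id.
  have := tame_le_Rintegral gauge_normal (tameD gauge_normal t1 tt) (tame_exp_line t)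
    (fun x => expR_ge1Dx (t * x)).
  by rewrite normal_Rmgf (tame_RintegralD gauge_normal t1 tt) Rintegral_prob_cst
    (tame_RintegralZ gauge_normal t tame_id).
apply/eqP; apply: contraT => m0.
(* The choice [t = m / (1 + m ^ 2)] contradicts [h] since
   [expR (t ^ 2 / 2) <= (1 - t ^ 2 / 2)^-1]. *)
have q0 : 0 < m ^+ 2 by rewrite exprn_even_gt0.
move: q0 (h (m / (1 + m ^+ 2))); set q := m ^+ 2 => q0.
rewrite expr_div_n -/q mulrAC -expr2 -/q.
set c := (1 + q)^-1.
have c0 : 0 < c by rewrite invr_gt0; lra.
have cq : c * (1 + q) = 1 by rewrite mulVf// gt_eqF//; lra.
have := expR_ge1Dx (- (q / (1 + q) ^+ 2 / 2)); rewrite expRN.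
have := expR_gt0 (q / (1 + q) ^+ 2 / 2).
rewrite -(exprVn _ 2) -/c; move: (expR _) => e e0 h1 h2.
have : (1 - q * c ^+ 2 / 2) * (1 + q * c) <= 1.
  rewrite (le_trans (ler_wpM2r _ h1))//; first nra.
  by rewrite mulrC ler_pdivrMr// mul1r.
have -> : q * c = 1 - c by nra.
have -> : q * c ^+ 2 = (1 - c) * c by nra.
have : c < 1 by nra.
nra.
Qed.

(** [2 + t ^ 2 x ^ 2 <= 2 cosh (t x) <= 2 + t ^ 2 x ^ 2 + 2 t ^ 4 cosh x]
integrates to bounds on [V = E x ^ 2] in terms of [expR (t ^ 2 / 2)], and small
[t] forces [V <= 1] and [1 <= V]. *)
Lemma normal_var : \int[gamma]_x x ^+ 2 = 1.
Proof.
set V := (X in X = _).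
have tsq : tameR (fun x => x ^+ 2).
  by apply: (tameX gauge_normal); exact: tame_id.
have tch t : tameR (fun x => expR (t * x) + expR (- t * x)).
  by apply: (tameD gauge_normal); exact: tame_exp_line.
have Ech t : \int[gamma]_x (expR (t * x) + expR (- t * x)) = 2 * expR (t ^+ 2 / 2).
  rewrite (tame_RintegralD gauge_normal); [|exact: tame_exp_line..].
  by rewrite !normal_Rmgf sqrrN mulr_natl mulr2n.
have up t : 2 + t ^+ 2 * V <= 2 * expR (t ^+ 2 / 2).
  have t2 : tameR (cst (2:R)) by exact: (tame_cst gauge_normal).
  have tt : tameR (fun x => t ^+ 2 * x ^+ 2).
    by apply: (tameZ gauge_normal).
  have h x : 2 + t ^+ 2 * x ^+ 2 <= expR (t * x) + expR (- t * x).
    by rewrite -exprMn mulNr cosh_ge.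
  have := tame_le_Rintegral gauge_normal (tameD gauge_normal t2 tt) (tch t) h.
  by rewrite Ech (tame_RintegralD gauge_normal t2 tt) Rintegral_prob_cst
    (tame_RintegralZ gauge_normal _ tsq).
have lo t : 0 <= t <= 1 -> 2 * expR (t ^+ 2 / 2) <=
    2 + t ^+ 2 * V + t ^+ 4 * (2 * expR (1 / 2)).
  move=> t01.
  have t2 : tameR (cst (2:R)) by exact: (tame_cst gauge_normal).
  have tt : tameR (fun x => t ^+ 2 * x ^+ 2).
    by apply: (tameZ gauge_normal).
  have t4 := tameZ gauge_normal (t ^+ 4) (tch 1).
  have t3 := tameD gauge_normal t2 tt.
  have := tame_le_Rintegral gauge_normal (tch t) (tameD gauge_normal t3 t4)
    (fun x => cosh_le x t01).
  rewrite Ech (tame_RintegralD gauge_normal t3 t4) (tame_RintegralD gauge_normal t2 tt).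
  rewrite Rintegral_prob_cst.
  by rewrite !(tame_RintegralZ gauge_normal)// Ech expr1n.
have V0 : 0 <= V by apply: Rintegral_ge0 => x _; exact: sqr_ge0.
(* Both bounds are rewritten with [w = t ^ 2]. *)
have {}up w : 0 <= w -> w < 2 -> V * (1 - w / 2) * w <= w.
  move=> w0 w2; have := up (Num.sqrt w); rewrite sqr_sqrtr//.
  have := expR_ge1Dx (- (w / 2)); rewrite expRN.
  have := expR_gt0 (w / 2); move: (expR _) => e e0 h1 h2.
  have : (1 - w / 2) * e <= 1.
    by rewrite -ler_pdivlMr// mul1r.
  have : (2 + w * V) * (1 - w / 2) <= 2 * e * (1 - w / 2).
    by rewrite ler_wpM2r//; lra.
  by lra.
have {}lo w : 0 <= w <= 1 -> w <= w * V + w ^+ 2 * (2 * expR (1 / 2)).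
  move=> /andP[w0 w1]; have := lo (Num.sqrt w).
  have sw1 : Num.sqrt w <= 1 by rewrite -[leRHS]sqrtr1 ler_sqrt.
  rewrite (exprM _ 2 2) sqr_sqrtr// sqrtr_ge0.
  by move=> /(_ sw1); have := expR_ge1Dx (w / 2); lra.
apply/eqP; rewrite eq_le; apply/andP; split; rewrite leNgt; apply/negP => hV.
  have V1 : 0 < V by lra.
  have w0 : 0 < (V - 1) / V by rewrite divr_gt0// subr_gt0.
  have wV : (V - 1) / V * V = V - 1 by rewrite divfK// gt_eqF.
  have := up ((V - 1) / V) (ltW w0); move: w0 wV; set w := (V - 1) / V => w0 wV.
  have w2 : w < 2 by nra.
  move=> /(_ w2); rewrite -[leRHS]mul1r ler_pM2r//.
  by nra.
have C1 : 1 <= expR (1 / 2 : R) by rewrite -[leLHS]expR0 ler_expR; lra.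
move: lo C1; move: (expR _) => C lo C1.
have w0 : 0 < (1 - V) / (4 * C) by rewrite divr_gt0//; lra.
have wC : (1 - V) / (4 * C) * (4 * C) = 1 - V by rewrite divfK// gt_eqF//; lra.
have := lo ((1 - V) / (4 * C)); move: w0 wC; set w := (1 - V) / (4 * C) => w0 wC.
have w1 : 0 <= w <= 1 by nra.
move=> /(_ w1); rewrite expr2 -mulrA -mulrDr -[leLHS]mulr1 ler_pM2l//.
by nra.
Qed.

Lemma gauss_momentE (k : nat) :
  gauss_moment R k = (\int[gamma]_x (`|x| ^+ k))%:E.
Proof.
rewrite /gauss_moment unlock (tame_integralE gauge_normal)//.
apply: (tameX gauge_normal); apply: lin_growth_tame.
exact: (lin_growth_gauge gauge_normal).
Qed.

End standard_normal_moments.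

(** * Linear forms of a Gaussian vector *)

Section gaussian_vectors.
Context {R : realType} {d : measure_display} {T : measurableType d}
  {P : probability T R} {p : nat} (Z : 'I_p -> {RV P >-> R})
  (mu : 'cV[R]_p) (Sigma : 'M[R]_p).
Local Notation gamma := (@normal_prob R 0 1).

(** [a] applied to the centered vector [G = Z - mu]. *)
Definition lin_form (a : 'cV[R]_p) (w : T) : R :=
  \sum_(i < p) a i 0 * (Z i w - mu i 0).

Definition abs_coord_sum (w : T) : R := \sum_(i < p) `|Z i w - mu i 0|.

Lemma measurable_RV i : measurable_fun setT (Z i : T -> R).
Proof. exact: measurable_funPT. Qed.

Lemma measurable_lin_form a : measurable_fun setT (lin_form a).
Proof.
apply: measurable_sum => i; apply: measurable_funM => //.
by apply: measurable_funB => //; exact: measurable_RV.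
Qed.

Hypothesis hZ : gaussian_with Z mu Sigma.

(** The degenerate law is the image of the standard normal law by a constant map,
so one formula covers both cases of the definition of a Gaussian law. *)
Lemma gaussian_law_affine (a : 'cV[R]_p) : exists m s : R, 0 <= s /\ forall f : R -> R,
  continuous f -> (forall x, 0 <= f x) ->
  (\int[P]_w (f (lin_form a w))%:E = \int[gamma]_x (f (m + s * x)%R)%:E)%E.
Proof.
case: hZ => /(_ a)[m [s Has]] _ _.
pose c := \sum_(i < p) a i 0 * mu i 0.
exists (m - c), `|s|; split => // f cf f0.
pose X (w : T) : measurableTypeR R := \sum_(i < p) a i 0 * Z i w.
have mX : measurable_fun setT X.
  by apply: measurable_sum => i; apply: measurable_funM => //; exact: measurable_RV.
pose g x := f (x - c).
have cg : continuous g.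
  move=> x; apply: continuous_comp; [|exact: cf].
  by apply: cvgB; [exact: cvg_id|exact: cvg_cst].
have g0 x : 0 <= g x by exact: f0.
have mg : measurable_fun setT g by exact: continuous_measurable_fun.
transitivity (\int[P]_w (g (X w))%:E)%E.
  apply: eq_integral => w _; congr (f _)%:E; rewrite /lin_form /X /c -sumrB.
  by apply: eq_bigr => i _; rewrite mulrBr.
transitivity (\int[pushforward P X]_x (g x)%:E)%E.
  rewrite ge0_integral_pushforward//; first exact/measurable_EFinP.
  by move=> x _; rewrite lee_fin.
transitivity (\int[gamma]_x (g (m + `|s| * x))%:E)%E; last first.
  by apply: eq_integral => x _; rewrite /g addrAC.
have [s0|s0] := eqVneq s 0.
  transitivity (\int[@dirac _ (measurableTypeR R) m R]_x (g x)%:E)%E.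
    apply: eq_measure_integral.
    move=> A mA _; transitivity (gaussian_law m s A); first exact: Has.
    by rewrite /gaussian_law s0 eqxx.
  rewrite integral_dirac//; last exact/measurable_EFinP.
  rewrite diracT mul1e s0 normr0.
  under eq_integral do rewrite mul0r addr0.
  by rewrite integral_cst// [X in (_ * X)%E]probability_setT mule1.
transitivity (\int[normal_prob m s]_x (g x)%:E)%E.
  apply: eq_measure_integral.
  move=> A mA _; transitivity (gaussian_law m s A); first exact: Has.
  by rewrite /gaussian_law (negbTE s0).
rewrite normal_prob_abs ge0_integral_normal_affine//.
by rewrite normr_gt0.
Qed.

(** [expR (k * N)] is one of the terms of the sum, over all sign patterns [e], of
the exponentials of the linear forms with coefficients [k * (-1) ^ e i], and
each of these is integrable. *)
Lemma gauge_abs_coord_sum : gauge (P := P) abs_coord_sum.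
Proof.
have mabs : measurable_fun setT abs_coord_sum.
  apply: measurable_sum => i; apply: measurableT_comp => //.
  by apply: measurable_funB => //; exact: measurable_RV.
split => //; first by move=> w; apply: sumr_ge0.
move=> k.
have ie (a : 'cV[R]_p) : P.-integrable setT (fun w => (expR (lin_form a w))%:E).
  apply/integrableP; split.
    by apply/measurable_EFinP/measurableT_comp => //; exact: measurable_lin_form.
  under eq_integral do rewrite /= ger0_norm ?expR_ge0//.
  have [m [s [_ ->]]] := gaussian_law_affine a; last 2 first.
  - exact: continuous_expR.
  - exact: expR_ge0.
  under eq_integral do rewrite expRD EFinM.
  rewrite ge0_integralZl//; last first.
    by apply/measurable_EFinP/measurableT_comp => //; exact: measurable_funM.
  by rewrite normal_mgf ltry.
pose sg (e : {ffun 'I_p -> bool}) : 'cV[R]_p := \col_i (k%:R * (-1) ^+ e i).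
have isum : P.-integrable setT
    (fun w => (\sum_(e : {ffun 'I_p -> bool}) (expR (lin_form (sg e) w))%:E)%E).
  by apply: integrable_sum => // e _; exact: ie.
have := integrableZl measurableT (expR k%:R) isum.
apply: le_integrable => //.
  apply/measurable_EFinP/measurableT_comp => //; apply: measurable_funM => //.
  exact: measurable_funD.
move=> w _; rewrite sumEFin -EFinM /= lee_fin (ger0_norm (expR_ge0 _)).
apply: le_trans (ler_norm _).
rewrite mulrDr mulr1 expRD mulrC ler_wpM2l ?expR_ge0//.
pose e := [ffun i => Z i w - mu i 0 < 0].
rewrite (bigD1 e)//= [leLHS](_ : _ = expR (lin_form (sg e) w)); last first.
  congr expR; rewrite mulr_sumr; apply: eq_bigr => i _.
  rewrite !mxE ffunE -mulrA; congr (_ * _).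
  exact: normrEsign.
by rewrite lerDl sumr_ge0// => *; exact: expR_ge0.
Qed.

Local Notation tameP := (@tame R d T abs_coord_sum).

Lemma lin_growth_coord i : lin_growth abs_coord_sum (fun w => Z i w - mu i 0).
Proof.
split; first by apply: measurable_funB => //; exact: measurable_RV.
exists 1%N => w; rewrite mul1r /abs_coord_sum (bigD1 i)//= -addrA lerDl.
by rewrite addr_ge0// sumr_ge0.
Qed.

Lemma lin_growth_lin_form a : lin_growth abs_coord_sum (lin_form a).
Proof.
apply: (lin_growth_sum gauge_abs_coord_sum) => i.
by apply: (lin_growthZ gauge_abs_coord_sum); exact: lin_growth_coord.
Qed.

Lemma tame_RV i : tameP (Z i).
Proof.
have := tameD gauge_abs_coord_sum (lin_growth_tame (lin_growth_coord i))
  (tame_cst gauge_abs_coord_sum (mu i 0)).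
by under eq_fun do rewrite /cst subrK.
Qed.

Lemma lin_form_mean a : \int[P]_w lin_form a w = 0.
Proof.
case: hZ => _ hm _.
rewrite (tame_Rintegral_sum gauge_abs_coord_sum) => [|i]; last first.
  by apply: (tameZ gauge_abs_coord_sum); apply: lin_growth_tame; exact: lin_growth_coord.
apply: big1 => i _; rewrite (tame_RintegralZ gauge_abs_coord_sum); last first.
  by apply: lin_growth_tame; exact: lin_growth_coord.
rewrite (tame_RintegralB gauge_abs_coord_sum);
  [|exact: tame_RV|exact: (tame_cst gauge_abs_coord_sum)].
rewrite Rintegral_prob_cst; have := hm i; rewrite unlock
  (tame_integralE gauge_abs_coord_sum (tame_RV i)).
by move=> [->]; rewrite subrr mulr0.
Qed.

Lemma coord_covariance i j :
  \int[P]_w ((Z i w - mu i 0) * (Z j w - mu j 0)) = Sigma i j.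
Proof.
case: hZ => _ hm /(_ i j).
rewrite unlock !hm/= unlock (tame_integralE gauge_abs_coord_sum); first by case.
by apply: (tameM (N := abs_coord_sum)); apply: lin_growth_tame; exact: lin_growth_coord.
Qed.

Lemma lin_form_var a : \int[P]_w lin_form a w ^+ 2 = quad_form Sigma a.
Proof.
have tc i := lin_growth_tame (lin_growth_coord i).
transitivity (\int[P]_w (\sum_i \sum_j
    a i 0 * a j 0 * ((Z i w - mu i 0) * (Z j w - mu j 0)))).
  apply: eq_Rintegral => w _; rewrite expr2 /lin_form mulr_suml.
  apply: eq_bigr => i _; rewrite mulr_sumr; apply: eq_bigr => j _.
  by rewrite mulrACA.
have tij i j : tameP (fun w => a i 0 * a j 0 * ((Z i w - mu i 0) * (Z j w - mu j 0))).
  by apply: (tameZ gauge_abs_coord_sum); exact: tameM.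
rewrite (tame_Rintegral_sum gauge_abs_coord_sum); last first.
  by move=> i; apply: (tame_sum gauge_abs_coord_sum).
under eq_bigr => i _.
  rewrite (tame_Rintegral_sum gauge_abs_coord_sum); last by move=> j.
  under eq_bigr => j _.
    rewrite (tame_RintegralZ gauge_abs_coord_sum); last exact: tameM.
    rewrite coord_covariance.
    over.
  over.
rewrite /quad_form !mxE exchange_big/=; apply: eq_bigr => j _.
rewrite !mxE mulr_suml; apply: eq_bigr => i _.
by rewrite !mxE mulrAC.
Qed.

Lemma quad_form_cov_ge0 a : 0 <= quad_form Sigma a.
Proof. by rewrite -lin_form_var; apply: Rintegral_ge0 => w _; exact: sqr_ge0. Qed.

(** The location and scale of the law of a linear form are identified by its
mean and variance: the shifted second moment [E (a.G + 1) ^ 2] gives the mean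
without leaving nonnegative integrands. *)
Lemma integral_lin_form a (f : R -> R) : continuous f -> (forall x, 0 <= f x) ->
  (\int[P]_w (f (lin_form a w))%:E =
   \int[gamma]_x (f (Num.sqrt (quad_form Sigma a) * x)%R)%:E)%E.
Proof.
move=> cf f0; have [m [s [s0 law]]] := gaussian_law_affine a.
have tl := lin_growth_tame (lin_growth_lin_form a).
have E2 c : \int[P]_w (lin_form a w + c) ^+ 2 = (m + c) ^+ 2 + s ^+ 2.
  have cc : continuous (fun x : R => (x + c) ^+ 2).
    move=> x; apply: (@continuous_comp _ _ _ (+%R^~ c) (fun y => y ^+ 2)).
      by apply: cvgD; [exact: cvg_id|exact: cvg_cst].
    exact: exprn_continuous.
  rewrite /Rintegral (law _ cc (fun x => sqr_ge0 (x + c))) -/(Rintegral _ _ _).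
  have tx := @tame_id R.
  have t1 := tameZ gauge_normal (2 * (m + c) * s) tx.
  have t2 := tameZ gauge_normal (s ^+ 2) (tameX gauge_normal 2 tx).
  have t0 := tame_cst (@gauge_normal R) ((m + c) ^+ 2).
  transitivity (\int[gamma]_x
      ((m + c) ^+ 2 + (2 * (m + c) * s * x + s ^+ 2 * x ^+ 2))).
    by apply: eq_Rintegral => x _; ring.
  rewrite (tame_RintegralD gauge_normal t0 (tameD gauge_normal t1 t2)).
  rewrite (tame_RintegralD gauge_normal t1 t2) (Rintegral_prob_cst (P := gamma)).
  rewrite (tame_RintegralZ gauge_normal _ tx) normal_mean mulr0 add0r.
  by rewrite (tame_RintegralZ gauge_normal _ (tameX gauge_normal 2 tx)) normal_var mulr1.
have q0 : quad_form Sigma a = m ^+ 2 + s ^+ 2.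
  by have := E2 0; rewrite addr0 -lin_form_var; under eq_Rintegral do rewrite addr0.
have q1 : quad_form Sigma a + 1 = (m + 1) ^+ 2 + s ^+ 2.
  rewrite -E2 -lin_form_var.
  have tl2 := tameX gauge_abs_coord_sum 2 tl.
  have tc := tame_cst gauge_abs_coord_sum (1 : R).
  have tl1 := tameD gauge_abs_coord_sum (tameZ gauge_abs_coord_sum 2 tl) tc.
  transitivity (\int[P]_w (lin_form a w ^+ 2 + (2 * lin_form a w + 1))).
    rewrite (tame_RintegralD gauge_abs_coord_sum tl2 tl1).
    rewrite (tame_RintegralD gauge_abs_coord_sum (tameZ gauge_abs_coord_sum 2 tl) tc).
    rewrite Rintegral_prob_cst.
    by rewrite (tame_RintegralZ gauge_abs_coord_sum _ tl) lin_form_mean mulr0 add0r.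
  by apply: eq_Rintegral => w _; ring.
have m0 : m = 0 by move: q1; rewrite q0 sqrrD1; lra.
rewrite q0 m0 expr0n/= add0r sqrtr_sqr.
transitivity (\int[gamma]_x (f (s * x))%:E)%E.
  by rewrite law// m0; under eq_integral do rewrite add0r.
by rewrite ger0_norm.
Qed.

(** The law of the linear form is that of [sqrt (quad_form Sigma a)] times a
standard normal variable. *)
Lemma lin_form_mgf a : \int[P]_w expR (lin_form a w) = expR (quad_form Sigma a / 2).
Proof.
rewrite /Rintegral integral_lin_form; last 2 first.
- exact: continuous_expR.
- exact: expR_ge0.
by rewrite normal_mgf/= sqr_sqrtr// quad_form_cov_ge0.
Qed.

Lemma lin_form_moment a r : (\int[P]_w (lin_form a w ^+ (2 * r))%:E =
  (quad_form Sigma a ^+ r * \int[gamma]_x (`|x| ^+ (2 * r)))%:E)%E.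
Proof.
have h (x : R) : 0 <= x ^+ (2 * r) by rewrite exprM exprn_ge0// sqr_ge0.
rewrite (integral_lin_form a (f := fun x => x ^+ (2 * r)))//; last first.
  exact: exprn_continuous.
under eq_integral do rewrite exprMn exprM sqr_sqrtr ?quad_form_cov_ge0//.
have tx := tameX (@gauge_normal R) (2 * r) (tame_norm (@tame_id R)).
rewrite (tame_integralE gauge_normal); last first.
  have := tameZ gauge_normal (quad_form Sigma a ^+ r)
    (tameX (@gauge_normal R) (2 * r) (@tame_id R)).
  by [].
congr _%:E; rewrite -(tame_RintegralZ gauge_normal _ tx); apply: eq_Rintegral => x _.
by rewrite [`|_| ^+ _]exprM real_normK ?num_real// -exprM.
Qed.

End gaussian_vectors.

(** * Two independent copies *)

Section independent_copies.
Context {R : realType} {d : measure_display} {T : measurableType d}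
  {P : probability T R}.
Variable N : T -> R.
Hypothesis gN : gauge (P := P) N.
Local Notation Q := (P \x P)%E.

Definition gauge2 (w : T * T) : R := N w.1 + N w.2.

Lemma ge0_integral_prod (F G : T -> R) :
  measurable_fun setT F -> measurable_fun setT G ->
  (forall x, 0 <= F x) -> (forall x, 0 <= G x) ->
  (\int[Q]_w (F w.1 * G w.2)%:E =
   (\int[P]_x (F x)%:E) * (\int[P]_x (G x)%:E))%E.
Proof.
move=> mF mG F0 G0.
have mFG : measurable_fun setT (fun w : T * T => (F w.1 * G w.2)%:E).
  apply/measurable_EFinP; apply: measurable_funM.
    by apply: measurableT_comp => //; exact: measurable_fst.
  by apply: measurableT_comp => //; exact: measurable_snd.
rewrite (fubini_tonelli1 (m1 := P) (m2 := P))//; last first.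
  by move=> x; rewrite lee_fin mulr_ge0.
have mEF := (measurable_EFinP _ _).2 mF.
have mEG := (measurable_EFinP _ _).2 mG.
transitivity (\int[P]_x ((F x)%:E * \int[P]_y (G y)%:E))%E.
  apply: eq_integral => x _; rewrite /fubini_F/= -ge0_integralZl ?lee_fin//.
  by move=> y _; rewrite lee_fin.
rewrite ge0_integralZr//; first by move=> y _; rewrite lee_fin.
by apply: integral_ge0 => y _; rewrite lee_fin.
Qed.

(** The exponential of [k (gauge2 w + 1)] is at most the product of two integrable
functions, one for each copy. *)
Lemma gauge_gauge2 : gauge (P := Q) gauge2.
Proof.
case: gN => mN N0 iN.
have m2 : measurable_fun setT gauge2.
  apply: measurable_funD.
    by apply: measurableT_comp => //; exact: measurable_fst.
  by apply: measurableT_comp => //; exact: measurable_snd.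
split => //; first by move=> w; rewrite addr_ge0.
move=> k; pose e x := expR (k%:R * (N x + 1)).
have me : measurable_fun setT e.
  by apply: measurableT_comp => //; apply: measurable_funM => //; exact: measurable_funD.
have ie : Q.-integrable setT (fun w => (e w.1 * e w.2)%:E).
  apply/integrableP; split.
    apply/measurable_EFinP; apply: measurable_funM.
      by apply: measurableT_comp => //; exact: measurable_fst.
    by apply: measurableT_comp => //; exact: measurable_snd.
  under eq_integral do rewrite /= ger0_norm ?mulr_ge0 ?expR_ge0//.
  rewrite ge0_integral_prod//; [|by move=> x; exact: expR_ge0..].
  have te : tame N e by split => //; exists k => x; rewrite /e ger0_norm ?expR_ge0.
  by rewrite (tame_integralE gN te) ltry.
apply: le_integrable ie => //.
  apply/measurable_EFinP; apply: measurableT_comp => //.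
  by apply: measurable_funM => //; exact: measurable_funD.
move=> w _ /=; rewrite lee_fin (le_trans _ (ler_norm _))//.
rewrite ger0_norm ?expR_ge0// /e -expRD ler_expR -mulrDr ler_wpM2l//.
by rewrite /gauge2; lra.
Qed.

Lemma tame_fst F : tame N F -> tame gauge2 (fun w => F w.1).
Proof.
case: gN => mN N0 _ [mF [k Fk]]; split.
  by apply: measurableT_comp => //; exact: measurable_fst.
exists k => w; apply: (le_trans (Fk _)); rewrite ler_expR ler_wpM2l//.
by rewrite lerD2r lerDl.
Qed.

Lemma tame_snd F : tame N F -> tame gauge2 (fun w => F w.2).
Proof.
case: gN => mN N0 _ [mF [k Fk]]; split.
  by apply: measurableT_comp => //; exact: measurable_snd.
exists k => w; apply: (le_trans (Fk _)); rewrite ler_expR ler_wpM2l//.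
by rewrite lerD2r lerDr.
Qed.

Lemma lin_growth_fst F : lin_growth N F -> lin_growth gauge2 (fun w => F w.1).
Proof.
case: gN => mN N0 _ [mF [k Fk]]; split.
  by apply: measurableT_comp => //; exact: measurable_fst.
exists k => w; apply: (le_trans (Fk _)); rewrite ler_wpM2l//.
by rewrite lerD2r lerDl.
Qed.

Lemma lin_growth_snd F : lin_growth N F -> lin_growth gauge2 (fun w => F w.2).
Proof.
case: gN => mN N0 _ [mF [k Fk]]; split.
  by apply: measurableT_comp => //; exact: measurable_snd.
exists k => w; apply: (le_trans (Fk _)); rewrite ler_wpM2l//.
by rewrite lerD2r lerDr.
Qed.

(** Tonelli's theorem for tame factors. *)
Lemma Rintegral_prod (F G : T -> R) : tame N F -> tame N G ->
  (forall x, 0 <= F x) -> (forall x, 0 <= G x) ->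
  \int[Q]_w (F w.1 * G w.2) = (\int[P]_x F x) * (\int[P]_x G x).
Proof.
move=> tF tG F0 G0; rewrite {1}/Rintegral ge0_integral_prod//; [|exact: tF.1|exact: tG.1].
by rewrite (tame_integralE gN tF) (tame_integralE gN tG).
Qed.

(** Subtracting an independent copy only increases even central moments, by
Jensen's inequality applied to the copy. *)
Lemma symmetrization F (r : nat) : (0 < r)%N -> tame N F ->
  \int[P]_x (F x - \int[P]_y F y) ^+ (2 * r) <=
  \int[Q]_w (F w.1 - F w.2) ^+ (2 * r).
Proof.
move=> r0 tF; set c := \int[P]_y F y.
have tL := tameX gN (2 * r) (tameB gN tF (tame_cst gN c)).
have tR := tameX gauge_gauge2 (2 * r) (tameB gauge_gauge2 (tame_fst tF) (tame_snd tF)).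
have ev (x : R) : 0 <= x ^+ (2 * r) by rewrite exprM exprn_ge0// sqr_ge0.
rewrite -lee_fin -(tame_integralE gN tL) -(tame_integralE gauge_gauge2 tR).
have mR : measurable_fun setT (fun w : T * T => ((F w.1 - F w.2) ^+ (2 * r))%:E).
  exact: ((measurable_EFinP _ _).2 tR.1).
have R0 (w : T * T) : (0 <= ((F w.1 - F w.2) ^+ (2 * r))%:E)%E.
  by rewrite lee_fin.
rewrite (fubini_tonelli1 (m1 := P) (m2 := P) _ mR R0).
apply: ge0_le_integral => //.
- by move=> x _; rewrite lee_fin.
- exact: ((measurable_EFinP _ _).2 tL.1).
- exact: (measurable_fun_fubini_tonelli_F (m2 := P) _ mR R0).
move=> x _; rewrite /fubini_F/=.
have tx := tameB gN (tame_cst gN (F x)) tF.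
rewrite (tame_integralE gN (tameX gN (2 * r) tx)) lee_fin.
apply: le_trans (jensen_exprn_even gN r0 tx).
by rewrite (tame_RintegralB gN (tame_cst gN (F x)) tF) Rintegral_prob_cst.
Qed.

End independent_copies.

(** * Rotations of a Gaussian pair *)

Section rotation_speed.
Context {R : realType}.
Variables x y : R.
Let phi h := expR (cos h * x + sin h * y).

Lemma is_derive_rot_exp h : is_derive h (1 : R) phi ((cos h * y - sin h * x) * phi h).
Proof.
pose g h : R := cos h * x + sin h * y.
have dg : is_derive h (1 : R) g (cos h * y - sin h * x).
  apply: is_derive_eq; rewrite !scaler0 !add0r addrC.
  by rewrite -[x *: _]/(x * - sin h) -[y *: _]/(y * cos h); ring.
by rewrite mulrC; exact: (@is_derive1_comp R expR g h (phi h)).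
Qed.

(** By the mean value theorem, since the derivative of [phi] is at most
[(|x| + |y|) * expR (|x| + |y|)] in absolute value. *)
Lemma rot_exp_lipschitz h : 0 <= h ->
  `|phi h - phi 0| <= h * expR (2 * (`|x| + `|y|)).
Proof.
move=> h0; have dphi t := is_derive_rot_exp t.
have cphi : {within `[0, h], continuous phi}.
  by apply: derivable_within_continuous => t _; exact: ex_derive.
have [t _ ->] := @MVT_segment R phi (fun t => (cos t * y - sin t * x) * phi t)
  0 h h0 (fun t _ => dphi t) cphi.
rewrite subr0 normrM (ger0_norm h0) mulrC ler_wpM2l// normrM (ger0_norm (expR_ge0 _)).
have cx (u v : R) : `|u| <= 1 -> `|u * v| <= `|v|.
  by move=> u1; rewrite normrM ler_piMl.
have c1 : `|cos t| <= 1 by rewrite ler_norml cos_geN1 cos_le1.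
have s1 : `|sin t| <= 1 by rewrite ler_norml sin_geN1 sin_le1.
have -> : expR (2 * (`|x| + `|y|)) = expR (`|x| + `|y|) * expR (`|x| + `|y|).
  by rewrite -expRD; congr expR; ring.
rewrite ler_pM// ?expR_ge0//.
- apply: (@le_trans _ _ (`|x| + `|y|)).
    by rewrite (le_trans (ler_normB _ _))// addrC lerD// cx.
  by apply: le_trans (expR_ge1Dx _); rewrite lerDr.
- rewrite ler_expR (le_trans (ler_norm _))// (le_trans (ler_normD _ _))//.
  by rewrite lerD// cx.
Qed.

Lemma rot_exp_cvg (l : R) : 0 < l ->
  n.+1%:R * (phi 0 - phi (l / n.+1%:R)) @[n --> \oo] --> - (l * (y * expR x)).
Proof.
move=> l0; have d0 := is_derive_rot_exp 0.
have dphi0 : derivable phi 0 1 by exact: ex_derive.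
have dval : 'D_1 phi 0 = y * expR x.
  by rewrite derive_val /phi cos0 sin0 !mul1r !mul0r subr0 addr0.
have /cvgr_dnbhsP hd : h^-1 *: (phi (h *: 1 + 0) - phi 0) @[h --> 0^'] --> y * expR x.
  by rewrite -dval; exact: dphi0.
have ul : (l / n.+1%:R) @[n --> \oo] --> (0 : R).
  rewrite -(mulr0 l); apply: cvgM; first exact: cvg_cst.
  exact: cvg_harmonic.
have un0 n : l / n.+1%:R != 0 by rewrite mulf_neq0 ?invr_eq0 ?pnatr_eq0// gt_eqF.
have := hd (fun n => l / n.+1%:R) (conj un0 ul).
move=> /(cvgM (cvg_cst (- l))); rewrite mulNr.
apply: cvg_trans; apply: near_eq_cvg; apply: nearW => n /=.
rewrite scaler1 addr0 -[_ *: _]/(_ * _) invfM invrK.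
rewrite -mulrA -opprB mulrN mulNr -mulrN.
have l0' : l != 0 by rewrite gt_eqF.
by field.
Qed.

End rotation_speed.

Section rotations.
Context {R : realType} {d : measure_display} {T : measurableType d}
  {P : probability T R} {p : nat} (Z : 'I_p -> {RV P >-> R})
  (mu : 'cV[R]_p) (Sigma : 'M[R]_p).
Hypothesis hZ : gaussian_with Z mu Sigma.
Local Notation Q := (P \x P)%E.
Local Notation lin := (lin_form Z mu).
Local Notation N := (abs_coord_sum Z mu).
Let gN := gauge_abs_coord_sum hZ.
Let gQ := gauge_gauge2 gN.

Definition cov_form (a b : 'cV[R]_p) : R := (a^T *m Sigma *m b) 0 0.

Lemma lin_form_sum (I : finType) (c : I -> R) (a : I -> 'cV[R]_p) w :
  lin (\sum_i c i *: a i) w = \sum_i c i * lin (a i) w.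
Proof.
rewrite /lin_form; under [RHS]eq_bigr do rewrite mulr_sumr.
rewrite exchange_big/=; apply: eq_bigr => j _.
rewrite summxE mulr_suml; apply: eq_bigr => i _.
by rewrite !mxE mulrA.
Qed.

Lemma quad_form_sum (I : finType) (c : I -> R) (a : I -> 'cV[R]_p) :
  quad_form Sigma (\sum_i c i *: a i) =
  \sum_i \sum_j c i * c j * cov_form (a i) (a j).
Proof.
rewrite /quad_form /cov_form [_^T]linear_sum/= mulmx_suml mulmx_suml summxE.
apply: eq_bigr => i _; rewrite mulmx_sumr summxE; apply: eq_bigr => j _.
rewrite [_^T]linearZ/= -!scalemxAl -scalemxAr.
by rewrite scalerA [in LHS]mxE.
Qed.

(** [a] applied to the rotated vector [(cos t) G + (sin t) G'], where [G] and [G']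
are two independent copies of [Z - mu]. *)
Definition rot_form (t : R) (a : 'cV[R]_p) (w : T * T) : R :=
  cos t * lin a w.1 + sin t * lin a w.2.

Lemma lin_growth_rot t a : lin_growth (gauge2 N) (rot_form t a).
Proof.
have la := lin_growth_lin_form hZ a.
apply: (lin_growthD).
  by apply: (lin_growthZ gQ); exact: (lin_growth_fst gN).
by apply: (lin_growthZ gQ); exact: (lin_growth_snd gN).
Qed.

(** [cos] and [sin] combine into [cos (t i - t j)] when the covariances of the two
copies are added: this is the rotation invariance of the Gaussian pair. *)
Lemma rot_mgf (I : finType) (t : I -> R) (a : I -> 'cV[R]_p) :
  \int[Q]_w expR (\sum_i rot_form (t i) (a i) w) =
  expR ((\sum_i \sum_j cos (t i - t j) * cov_form (a i) (a j)) / 2).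
Proof.
pose A := \sum_i cos (t i) *: a i; pose B := \sum_i sin (t i) *: a i.
transitivity (\int[Q]_w (expR (lin A w.1) * expR (lin B w.2))).
  apply: eq_Rintegral => w _; rewrite -expRD; congr expR.
  by rewrite !lin_form_sum -big_split.
have te C : tame N (fun w => expR (lin C w)).
  by apply: tame_expR; exact: (lin_growth_lin_form hZ).
rewrite (Rintegral_prod gN (te A) (te B)); [|by move=> ?; exact: expR_ge0..].
rewrite !(lin_form_mgf hZ) -expRD -mulrDl !quad_form_sum; congr (expR (_ / 2)).
rewrite -big_split/=; apply: eq_bigr => i _; rewrite -big_split/=.
by apply: eq_bigr => j _; rewrite cosB mulrDl.
Qed.

(** The [n]-th power expands into exponentials of sums of rotated forms, whose
means only involve the differences of the angles. *)
Lemma rot_moment (J : finType) (c t : J -> R) (a : J -> 'cV[R]_p) (n : nat) :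
  \int[Q]_w (\sum_j c j * expR (rot_form (t j) (a j) w)) ^+ n =
  \sum_(f : {ffun 'I_n -> J}) (\prod_k c (f k)) *
    expR ((\sum_k \sum_l cos (t (f k) - t (f l)) *
       cov_form (a (f k)) (a (f l))) / 2).
Proof.
have te (f : {ffun 'I_n -> J}) : tame (gauge2 N)
    (fun w => expR (\sum_k rot_form (t (f k)) (a (f k)) w)).
  apply: tame_expR; apply: (lin_growth_sum gQ) => k.
  exact: lin_growth_rot.
transitivity (\int[Q]_w \sum_(f : {ffun 'I_n -> J}) (\prod_k c (f k)) *
    expR (\sum_k rot_form (t (f k)) (a (f k)) w)).
  apply: eq_Rintegral => w _.
  transitivity (\prod_(k < n) \sum_j c j * expR (rot_form (t j) (a j) w)).
    by rewrite prodr_const card_ord.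
  rewrite bigA_distr_bigA/=; apply: eq_bigr => f _.
  by rewrite big_split/= expR_sum.
rewrite (tame_Rintegral_sum gQ); last by move=> f; exact: (tameZ gQ).
by apply: eq_bigr => f _; rewrite (tame_RintegralZ gQ)// rot_mgf.
Qed.

Section exponential_polynomial.
Variables (J : finType) (c : J -> R) (a : J -> 'cV[R]_p).

Definition exp_poly (w : T) : R := \sum_j c j * expR (lin (a j) w).

(** The gradient, as a function of [G], of [exp_poly]. *)
Definition exp_grad (w : T) : 'cV[R]_p := \sum_j (c j * expR (lin (a j) w)) *: a j.

(** [exp_poly] evaluated at the rotated vector. *)
Definition rot_poly (t : R) (w : T * T) : R := \sum_j c j * expR (rot_form t (a j) w).

Lemma tame_exp_poly : tame N exp_poly.
Proof.
apply: (tame_sum gN) => j; apply: (tameZ gN); apply: tame_expR.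
exact: (lin_growth_lin_form hZ).
Qed.

Lemma tame_rot_poly t : tame (gauge2 N) (rot_poly t).
Proof.
apply: (tame_sum gQ) => j; apply: (tameZ gQ); apply: tame_expR.
exact: lin_growth_rot.
Qed.

(** Rotation invariance: the two increments involve angles with the same
differences. *)
Lemma rot_increment_moment (t h : R) n :
  \int[Q]_w (rot_poly t w - rot_poly (t + h) w) ^+ n =
  \int[Q]_w (rot_poly 0 w - rot_poly h w) ^+ n.
Proof.
pose c' (j : bool * J) := if j.1 then c j.2 else - c j.2.
pose th t (j : bool * J) := if j.1 then t else t + h.
have E u w : rot_poly u w - rot_poly (u + h) w =
    \sum_j c' j * expR (rot_form (th u j) (a j.2) w).
  rewrite -(pair_bigA _ (fun b j => c' (b, j) * expR (rot_form (th u (b, j)) (a j) w)))/=.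
  rewrite big_bool/= /c' /th/= /rot_poly -sumrN; congr (_ + _).
  by apply: eq_bigr => j _; rewrite mulNr.
have E0 w : rot_poly 0 w - rot_poly h w =
    \sum_j c' j * expR (rot_form (th 0 j) (a j.2) w) by rewrite -E add0r.
under eq_Rintegral do rewrite E.
under [RHS]eq_Rintegral do rewrite E0.
rewrite (rot_moment c' (th t) (fun j => a j.2)).
rewrite (rot_moment c' (th 0) (fun j => a j.2)).
apply: eq_bigr => f _; congr (_ * expR (_ / 2)).
apply: eq_bigr => k _; apply: eq_bigr => l _; congr (cos _ * _).
by rewrite /th; case: (f k).1; case: (f l).1; ring.
Qed.

(** The rotation by a right angle exchanges the two copies. It is cut into [n]
equal steps, which all have the same moments by rotation invariance; the power
mean inequality then bounds the whole by one rescaled step. *)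
Lemma rot_telescope (r n : nat) : (0 < r)%N -> (0 < n)%N ->
  \int[Q]_w (exp_poly w.1 - exp_poly w.2) ^+ (2 * r) <=
  \int[Q]_w (n%:R * (rot_poly 0 w - rot_poly (pi / 2 / n%:R) w)) ^+ (2 * r).
Proof.
move=> r0 n0; set h := pi / 2 / n%:R.
have n0' : n%:R != 0 :> R by rewrite pnatr_eq0 -lt0n.
pose D k w := rot_poly (k%:R * h) w - rot_poly (k%:R * h + h) w.
have tD k : tame (gauge2 N) (D k).
  by apply: (tameB gQ); exact: tame_rot_poly.
have tD2 k := tameX gQ (2 * r) (tD k).
have tS := tame_sum gQ (index_enum 'I_n) (fun k : 'I_n => tD2 k).
have tel w : exp_poly w.1 - exp_poly w.2 = \sum_(k < n) D k w.
  transitivity (rot_poly (0%:R * h) w - rot_poly (n%:R * h) w).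
    rewrite mul0r /h mulrC divfK//; congr (_ - _); apply: eq_bigr => j _.
      by rewrite /rot_form cos0 sin0 mul1r mul0r addr0.
    by rewrite /rot_form cos_pihalf sin_pihalf mul0r mul1r add0r.
  rewrite -(big_mkord xpredT (D ^~ w)) -opprB.
  rewrite -(telescope_sumr (fun k => rot_poly (k%:R * h) w) (leq0n n)) -sumrN.
  by apply: eq_bigr => k _; rewrite opprB /D -natr1 mulrDl mul1r.
have tE : tame (gauge2 N) (fun w => (exp_poly w.1 - exp_poly w.2) ^+ (2 * r)).
  apply: (tameX gQ); apply: (tameB gQ).
    by apply: (tame_fst gN); exact: tame_exp_poly.
  by apply: (tame_snd gN); exact: tame_exp_poly.
apply: (@le_trans _ _ (\int[Q]_w
    (n%:R ^+ (2 * r) * (n%:R^-1 * \sum_(k < n) D k w ^+ (2 * r))))).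
  apply: (tame_le_Rintegral gQ tE).
    by apply: (tameZ gQ); exact: (tameZ gQ).
  by move=> w; rewrite tel; exact: (power_mean_even (D ^~ w) r0 n0).
rewrite (tame_RintegralZ gQ); last exact: (tameZ gQ).
rewrite (tame_RintegralZ gQ _ tS) (tame_Rintegral_sum gQ)//.
under eq_bigr do rewrite rot_increment_moment.
rewrite sumr_const card_ord -[X in _ * (_ * X)]mulr_natl mulKf//.
have t0 : tame (gauge2 N) (fun w => (rot_poly 0 w - rot_poly h w) ^+ (2 * r)).
  by apply: (tameX gQ); apply: (tameB gQ); exact: tame_rot_poly.
rewrite -(tame_RintegralZ gQ _ t0); apply: (tame_le_Rintegral gQ).
- exact: (tameZ gQ).
- apply: (tameX gQ); apply: (tameZ gQ); apply: (tameB gQ); exact: tame_rot_poly.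
- by move=> w; rewrite exprMn.
Qed.

End exponential_polynomial.
End rotations.

(** * Pisier's inequality *)

Section pisier.
Context {R : realType} {d : measure_display} {T : measurableType d}
  {P : probability T R} {p : nat} (Z : 'I_p -> {RV P >-> R})
  (mu : 'cV[R]_p) (Sigma : 'M[R]_p).
Hypothesis hZ : gaussian_with Z mu Sigma.
Local Notation Q := (P \x P)%E.
Local Notation lin := (lin_form Z mu).
Local Notation N := (abs_coord_sum Z mu).
Local Notation gamma := (@normal_prob R 0 1).
Let gN := gauge_abs_coord_sum hZ.
Let gQ := gauge_gauge2 gN.
Variables (J : finType) (c : J -> R) (a : J -> 'cV[R]_p).
Local Notation f := (exp_poly Z mu c a).
Local Notation grad := (exp_grad Z mu c a).
Local Notation rotf := (rot_poly Z mu c a).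

Let lin_gradE (w : T * T) : lin (grad w.1) w.2 =
  \sum_j c j * expR (lin (a j) w.1) * lin (a j) w.2.
Proof. exact: lin_form_sum. Qed.

(** The integrability needed for the limit of the rescaled steps. *)
Lemma tame_lin_grad : tame (gauge2 N) (fun w => lin (grad w.1) w.2).
Proof.
under eq_fun do rewrite lin_gradE.
apply: (tame_sum gQ) => j; apply: (tameM (N := gauge2 N)).
  apply: (tameZ gQ); apply: (@tame_fst _ _ _ _ _ gN (fun w => expR (lin (a j) w))).
  by apply: tame_expR; exact: (lin_growth_lin_form hZ).
apply: (@tame_snd _ _ _ _ _ gN); apply: lin_growth_tame.
exact: (lin_growth_lin_form hZ).
Qed.

Lemma tame_quad_grad : tame N (fun w => quad_form Sigma (grad w)).
Proof.
under eq_fun do rewrite /exp_grad quad_form_sum.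
have te j : tame N (fun w => c j * expR (lin (a j) w)).
  by apply: (tameZ gN); apply: tame_expR; exact: (lin_growth_lin_form hZ).
apply: (tame_sum gN) => i; apply: (tame_sum gN) => j.
apply: (tameM (N := N)); last exact: (tame_cst gN).
exact: (tameM (te i) (te j)).
Qed.

(** Dominated convergence: up to a sign, a rescaled step tends pointwise to [pi / 2]
times the derivative of the rotation at angle [0], which pairs the gradient with
the independent copy, and the Lipschitz bound dominates it. *)
Lemma rot_increment_cvg (r : nat) :
  \int[Q]_w (n.+1%:R * (rotf 0 w - rotf (pi / 2 / n.+1%:R) w)) ^+ (2 * r)
    @[n --> \oo] -->
  \int[Q]_w (pi / 2 * lin (grad w.1) w.2) ^+ (2 * r).
Proof.
have l0 : 0 < pi / 2 :> R by rewrite divr_gt0 ?pi_gt0.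
move: (pi / 2) l0 => l l0.
pose G w := \sum_j `|c j| * (l * expR (2 * (`|lin (a j) w.1| + `|lin (a j) w.2|))).
have tG : tame (gauge2 N) G.
  apply: (tame_sum gQ) => j; do 2 apply: (tameZ gQ); apply: tame_expR.
  apply: (lin_growthZ gQ).
  have lf := lin_growth_lin_form hZ (a j).
  have lnorm (F : T * T -> R) : lin_growth (gauge2 N) F ->
      lin_growth (gauge2 N) (fun w => `|F w|).
    move=> [mF [k Fk]]; split; first exact: measurableT_comp.
    by exists k => w; rewrite normr_id.
  apply: (@lin_growthD _ _ _ (gauge2 N)
    (fun w => `|lin (a j) w.1|) (fun w => `|lin (a j) w.2|)).
    by apply: lnorm; exact: (lin_growth_fst gN).
  by apply: lnorm; exact: (lin_growth_snd gN).
have incE n w : n.+1%:R * (rotf 0 w - rotf (l / n.+1%:R) w) =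
    \sum_j c j * (n.+1%:R * (expR (rot_form Z mu 0 (a j) w) -
                             expR (rot_form Z mu (l / n.+1%:R) (a j) w))).
  rewrite /rot_poly -sumrB mulr_sumr; apply: eq_bigr => j _.
  by rewrite -mulrBr mulrCA.
apply: (tame_cvg_Rintegral gQ (G := fun w => G w ^+ (2 * r))).
- move=> n; apply: (proj1 (_ : tame (gauge2 N) _)).
  by apply: (tameX gQ); apply: (tameZ gQ); apply: (tameB gQ); exact: (tame_rot_poly hZ).
- by apply: (tameX gQ); apply: (tameZ gQ); exact: tame_lin_grad.
- exact: (tameX gQ).
- move=> w.
  have cv : (n.+1%:R * (rotf 0 w - rotf (l / n.+1%:R) w)) @[n --> \oo] -->
      - (l * lin (grad w.1) w.2).
    under eq_fun do rewrite incE.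
    rewrite lin_gradE mulr_sumr -sumrN.
    apply: cvg_sum => j.
    rewrite [X in _ --> X](_ : _ =
      c j * - (l * (lin (a j) w.2 * expR (lin (a j) w.1)))); last by ring.
    apply: cvgM; first exact: cvg_cst.
    exact: (@rot_exp_cvg R (lin (a j) w.1) (lin (a j) w.2) l l0).
  rewrite [X in _ --> X](_ : _ = (- (l * lin (grad w.1) w.2)) ^+ (2 * r)); last first.
    by rewrite !exprM sqrrN.
  by apply: (cvg_comp _ (fun x : R => x ^+ (2 * r)) cv); exact: exprn_continuous.
- move=> n w; rewrite normrX lerXn2r ?nnegrE//.
    by apply: sumr_ge0 => j _; rewrite mulr_ge0// mulr_ge0 ?expR_ge0// ltW.
  rewrite incE (le_trans (ler_norm_sum _ _ _))// ler_sum// => j _.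
  rewrite normrM ler_wpM2l// normrM distrC.
  rewrite (ger0_norm (ler0n _ _)) mulrC -ler_pdivlMr ?ltr0n//.
  have := @rot_exp_lipschitz R (lin (a j) w.1) (lin (a j) w.2) (l / n.+1%:R).
  by rewrite mulrAC; apply; rewrite divr_ge0// ltW.
Qed.

(** The second copy is integrated out: conditionally on the first one, the
gradient paired with it is a centered normal variable with variance
[quad_form Sigma (grad w)]. *)
Lemma pisier (r : nat) : (0 < r)%N ->
  \int[P]_w (f w - \int[P]_w' f w') ^+ (2 * r) <=
  (pi / 2) ^+ (2 * r) * \int[gamma]_x (`|x| ^+ (2 * r)) *
  \int[P]_w quad_form Sigma (grad w) ^+ r.
Proof.
move=> r0; apply: (le_trans (symmetrization gN r0 (tame_exp_poly hZ c a))).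
have tq := tameX gN r tame_quad_grad.
apply: (@le_trans _ _ (\int[Q]_w (pi / 2 * lin (grad w.1) w.2) ^+ (2 * r))).
  have cv := @rot_increment_cvg r.
  rewrite -(cvg_lim (@Rhausdorff R) cv); apply: limr_ge.
    by apply/cvg_ex; eexists; exact: cv.
  by apply: nearW => n; exact: (rot_telescope hZ c a r0 (ltn0Sn n)).
rewrite -lee_fin -(tame_integralE gQ); last first.
  by apply: (tameX gQ); apply: (tameZ gQ); exact: tame_lin_grad.
set K := \int[gamma]_x _.
have ev (x : R) : 0 <= x ^+ (2 * r) by rewrite exprM exprn_ge0// sqr_ge0.
rewrite -(tame_RintegralZ gN _ tq) -(tame_integralE gN (tameZ gN _ tq)).
have tl := tameX gQ (2 * r) (tameZ gQ (pi / 2) tame_lin_grad).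
have ml := (measurable_EFinP _ _).2 tl.1.
rewrite (fubini_tonelli1 (m1 := P) (m2 := P) _ ml); last first.
  by move=> w; rewrite lee_fin.
rewrite le_eqVlt; apply/orP; left; apply/eqP; apply: eq_integral => x _.
rewrite /fubini_F/=.
under eq_integral do rewrite exprMn EFinM.
rewrite ge0_integralZl//.
- by rewrite (lin_form_moment hZ) -EFinM; congr _%:E; rewrite -/K; ring.
- apply/measurable_EFinP/measurable_funX.
  exact: measurable_lin_form.
- by move=> y _; rewrite lee_fin.
- by rewrite lee_fin.
Qed.

End pisier.

(** * Operator norm and entrywise exponentials of a covariance *)

Section norms.
Context {R : realType}.

(** By Lagrange's identity the difference of the two sides is half the double sum
of [(a i * b j - a j * b i) ^ 2]. *)
Lemma cauchy_schwarz (I : finType) (a b : I -> R) :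
  (\sum_i a i * b i) ^+ 2 <= (\sum_i a i ^+ 2) * (\sum_i b i ^+ 2).
Proof.
have h : 0 <= \sum_i \sum_j (a i * b j - a j * b i) ^+ 2.
  by apply: sumr_ge0 => i _; apply: sumr_ge0 => j _; exact: sqr_ge0.
have e : \sum_i \sum_j (a i * b j - a j * b i) ^+ 2 =
    2 * ((\sum_i a i ^+ 2) * (\sum_i b i ^+ 2)) - 2 * (\sum_i a i * b i) ^+ 2.
  transitivity (\sum_i \sum_j (a i ^+ 2 * b j ^+ 2 + a j ^+ 2 * b i ^+ 2
      - 2 * ((a i * b i) * (a j * b j)))).
    by apply: eq_bigr => i _; apply: eq_bigr => j _; ring.
  under eq_bigr do rewrite sumrB big_split/=.
  have prod (u v : I -> R) : \sum_i \sum_j u i * v j = (\sum_i u i) * (\sum_j v j).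
    by rewrite mulr_suml; apply: eq_bigr => i _; rewrite mulr_sumr.
  rewrite sumrB big_split/= [X in _ + X - _]exchange_big/= !prod.
  under [X in _ - X]eq_bigr do rewrite -mulr_sumr.
  by rewrite -mulr_sumr prod; ring.
by move: h; rewrite e -mulrBr pmulr_rge0// subr_ge0.
Qed.

Variable p : nat.
Implicit Types (v : 'cV[R]_p) (A : 'M[R]_p).

Lemma norm2_ge0 v : 0 <= norm2 v.
Proof. exact: sqrtr_ge0. Qed.

Lemma norm2_sqr v : norm2 v ^+ 2 = \sum_i v i 0 ^+ 2.
Proof. by rewrite sqr_sqrtr// sumr_ge0// => i _; exact: sqr_ge0. Qed.

Lemma norm2Z (c : R) v : norm2 (c *: v) = `|c| * norm2 v.
Proof.
rewrite /norm2 -sqrtr_sqr -sqrtrM ?sqr_ge0// mulr_sumr; congr Num.sqrt.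
by apply: eq_bigr => i _; rewrite !mxE exprMn.
Qed.

Lemma norm2_coord v i : `|v i 0| <= norm2 v.
Proof.
rewrite -sqrtr_sqr ler_sqrt ?sumr_ge0// => [|j _]; last exact: sqr_ge0.
by rewrite (bigD1 i)//= lerDl sumr_ge0// => j _; exact: sqr_ge0.
Qed.

Lemma norm2_eq0 v : norm2 v = 0 -> v = 0.
Proof.
move=> v0; apply/colP => i; rewrite mxE; apply/normr0_eq0/le_anti.
by rewrite normr_ge0 -v0 norm2_coord.
Qed.

Lemma norm2_delta (i : 'I_p) : norm2 (delta_mx i 0 : 'cV[R]_p) = 1.
Proof.
rewrite /norm2 (bigD1 i)//= big1 => [|j ji]; rewrite !mxE ?eqxx.
  by rewrite addr0 expr1n sqrtr1.
by rewrite (negbTE ji) expr0n.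
Qed.

Let im A := [set norm2 (A *m v) | v in [set v : 'cV[R]_p | norm2 v = 1]].

(** By convention the supremum of an unbounded set is [0], so the comparison of
[opnorm] with its defining values rests on this bound. *)
Let im_ubound A : has_ubound (im A).
Proof.
exists (Num.sqrt (\sum_i \sum_j A i j ^+ 2)) => _ [v /= v1 <-].
rewrite ler_sqrt; last first.
  by apply: sumr_ge0 => i _; apply: sumr_ge0 => j _; exact: sqr_ge0.
apply: ler_sum => i _; rewrite mxE; apply: (le_trans (cauchy_schwarz _ _)).
by rewrite -norm2_sqr v1 expr1n mulr1.
Qed.

Lemma norm2_mulmx_unit A v : norm2 v = 1 -> norm2 (A *m v) <= opnorm A.
Proof. by move=> v1; apply: ub_le_sup; [exact: im_ubound|exists v]. Qed.

Lemma norm2_mulmx A v : norm2 (A *m v) <= opnorm A * norm2 v.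
Proof.
have [v0|vn0] := eqVneq (norm2 v) 0.
  rewrite (norm2_eq0 v0) mulmx0; move: (norm2Z 0 0 : norm2 (0 *: 0) = _).
  by rewrite scale0r normr0 mul0r => ->; rewrite mulr0.
have v1 : norm2 ((norm2 v)^-1 *: v) = 1.
  by rewrite norm2Z ger0_norm ?invr_ge0 ?norm2_ge0// mulVf.
have := norm2_mulmx_unit A v1.
rewrite -scalemxAr norm2Z ger0_norm ?invr_ge0 ?norm2_ge0//.
by rewrite mulrC ler_pdivrMr// lt0r vn0 norm2_ge0.
Qed.

Lemma opnorm_ge0 A : (0 < p)%N -> 0 <= opnorm A.
Proof.
move=> p0; apply: le_trans (norm2_mulmx_unit A (norm2_delta (Ordinal p0))).
exact: norm2_ge0.
Qed.

Lemma quad_form_le A v : quad_form A v <= opnorm A * norm2 v ^+ 2.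
Proof.
apply: (@le_trans _ _ (norm2 v * norm2 (A *m v))).
  rewrite /quad_form -mulmxA mxE.
  under eq_bigr do rewrite mxE.
  rewrite (le_trans (ler_norm _))// -sqrtr_sqr -sqrtrM; last first.
    by apply: sumr_ge0 => i _; exact: sqr_ge0.
  rewrite ler_sqrt; first exact: cauchy_schwarz.
  by rewrite mulr_ge0// sumr_ge0// => i _; exact: sqr_ge0.
by rewrite expr2 mulrCA ler_wpM2l ?norm2_ge0// norm2_mulmx.
Qed.

Lemma col_sqr_le A (i : 'I_p) : \sum_j A j i ^+ 2 <= opnorm A ^+ 2.
Proof.
have := norm2_mulmx_unit A (norm2_delta i).
rewrite -(ler_pXn2r (_ : 0 < 2)%N) ?nnegrE ?norm2_ge0//; last first.
  by apply: opnorm_ge0; exact: leq_ltn_trans (ltn_ord i).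
rewrite norm2_sqr; apply: le_trans; rewrite le_eqVlt; apply/orP; left; apply/eqP.
by apply: eq_bigr => j _; rewrite -colE mxE.
Qed.

Lemma entry_le A (i j : 'I_p) : `|A i j| <= opnorm A.
Proof.
have o0 : 0 <= opnorm A by apply: opnorm_ge0; exact: leq_ltn_trans (ltn_ord i).
rewrite -(ler_pXn2r (_ : 0 < 2)%N) ?nnegrE// real_normK ?num_real//.
apply: le_trans (col_sqr_le A j); rewrite (bigD1 i)//= lerDl sumr_ge0// => k _.
exact: sqr_ge0.
Qed.

End norms.

Lemma big_option (V : nmodType) (T : finType) (F : option T -> V) :
  \sum_o F o = F None + \sum_x F (Some x).
Proof.
rewrite (bigD1 None)//=; congr (_ + _).
rewrite (reindex_omap Some id)/=; last by case.
by apply: eq_bigl => x; rewrite eqxx.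
Qed.

Section covariance_series.
Context {R : realType} {p : nat} (S : 'M[R]_p).
Hypothesis S_sym : forall i j, S i j = S j i.
Hypothesis p_gt0 : (0 < p)%N.
Local Notation s := (opnorm S).
Let s0 : 0 <= s := opnorm_ge0 S p_gt0.

Let row_le i : \sum_j S i j ^+ 2 <= s ^+ 2.
Proof. by under eq_bigr do rewrite S_sym; exact: col_sqr_le. Qed.

(** Higher powers reduce to squares because each entry is at most [s]. *)
Lemma row_power_le i n : (1 < n)%N -> \sum_j `|S i j| ^+ n <= s ^+ n.
Proof.
case: n => [|[|n]]// _; rewrite [leRHS](_ : _ = s ^+ 2 * s ^+ n); last first.
  by rewrite -exprD.
apply: (@le_trans _ _ ((\sum_j S i j ^+ 2) * s ^+ n)); last first.
  by rewrite ler_wpM2r ?row_le// exprn_ge0.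
rewrite mulr_suml; apply: ler_sum => j _.
rewrite -(real_normK (num_real (S i j))) -addn2 addnC exprD ler_wpM2l ?exprn_ge0//.
by rewrite lerXn2r ?nnegrE// entry_le.
Qed.

(** The entrywise powers of [S] have operator norm at most [s ^ n]: for [n = 1]
by definition of the operator norm, for [n > 1] by Schur's test, since the rows
of [S] have Euclidean norm at most [s]. *)
Lemma hadamard_power_le (w : 'I_p -> R) n : (0 < n)%N ->
  \sum_i \sum_j w i * w j * S i j ^+ n <= (\sum_i w i ^+ 2) * s ^+ n.
Proof.
case: n => [|[|n]]// _.
  have := quad_form_le S (\col_i w i); rewrite norm2_sqr mulrC.
  under [in leRHS]eq_bigr do rewrite mxE.
  apply: le_trans; rewrite le_eqVlt; apply/orP; left; apply/eqP.
  rewrite /quad_form mxE exchange_big/=; apply: eq_bigr => j _.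
  rewrite !mxE mulr_suml; apply: eq_bigr => i _.
  by rewrite !mxE expr1 mulrAC.
set m := n.+2.
apply: (@le_trans _ _ (\sum_i \sum_j (w i ^+ 2 / 2 * `|S i j| ^+ m +
    w j ^+ 2 / 2 * `|S j i| ^+ m))).
  apply: ler_sum => i _; apply: ler_sum => j _.
  rewrite (S_sym j i) -mulrDl (le_trans (ler_norm _))// normrM normrX.
  rewrite ler_wpM2r ?exprn_ge0// normrM.
  have := sqr_ge0 (`|w i| - `|w j|).
  rewrite -(real_normK (num_real (w i))) -(real_normK (num_real (w j))).
  by rewrite sqrrB mulr2n; lra.
under eq_bigr do rewrite big_split/=.
rewrite big_split/= [X in _ + X]exchange_big/= -big_split mulr_suml/=.
apply: ler_sum => i _; rewrite -!mulr_sumr -mulrDl -splitr.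
by rewrite ler_wpM2l ?sqr_ge0// row_power_le.
Qed.

(** Sum the bounds on the entrywise powers over the exponential series. *)
Lemma exp_covariance_le (w : 'I_p -> R) :
  \sum_i \sum_j w i * w j * (expR (S i j) - 1) <= (expR s - 1) * \sum_i w i ^+ 2.
Proof.
pose W := \sum_i w i ^+ 2.
have := @taylor1_le_expR_sum R (option ('I_p * 'I_p))
  (fun o => if o is Some ij then - (w ij.1 * w ij.2) else W)
  (fun o => if o is Some ij then S ij.1 ij.2 else s).
have E (F : option ('I_p * 'I_p) -> R) :
    \sum_o F o = F None + \sum_i \sum_j F (Some (i, j)).
  by rewrite big_option/= pair_bigA; congr (_ + _); apply: eq_bigr => -[].
rewrite !E/= => h; have {h} : W + \sum_i \sum_j - (w i * w j) <=
    W * expR s + \sum_i \sum_j - (w i * w j) * expR (S i j).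
  apply: h => k k0; rewrite E/=.
  under eq_bigr do (under eq_bigr do rewrite mulNr; rewrite sumrN).
  by rewrite sumrN subr_ge0 hadamard_power_le.
have -> : \sum_i \sum_j w i * w j * (expR (S i j) - 1) =
    \sum_i \sum_j - (w i * w j) - \sum_i \sum_j - (w i * w j) * expR (S i j).
  rewrite -sumrB; apply: eq_bigr => i _; rewrite -sumrB; apply: eq_bigr => j _.
  by ring.
by rewrite -/W; lra.
Qed.

(** [(expR (2 * x) - 1) ^ 2 = expR (4 * x) - 2 * expR (2 * x) + 1], and the
Taylor coefficients [4 ^ k - 2 * 2 ^ k] of this function are nonnegative from
order two on, where [row_power_le] compares the powers. *)
Lemma exp_row_le i :
  \sum_j (expR (2 * S i j) - 1) ^+ 2 <= (expR (2 * s) - 1) ^+ 2.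
Proof.
pose sgn (o : option 'I_p) : R := if o is Some _ then - 1 else 1.
pose val (o : option 'I_p) : R := if o is Some j then S i j else s.
have E (F : bool * option 'I_p -> R) :
    \sum_b F b = F (true, None) + \sum_j F (true, Some j) +
                 (F (false, None) + \sum_j F (false, Some j)).
  rewrite (eq_bigr (fun b => F (b.1, b.2))); last by case.
  by rewrite -(pair_bigA _ (fun a b => F (a, b)))/= big_bool/= !big_option.
have := @taylor2_le_expR_sum R (bool * option 'I_p)%type
  (fun b => if b.1 then sgn b.2 else - 2 * sgn b.2)
  (fun b => if b.1 then 4 * val b.2 else 2 * val b.2).
rewrite !E/= => h.
have {h} : 1 + \sum_(j < p) - 1 + (- 2 * 1 + \sum_(j < p) - 2 * - 1) +
   (1 * (4 * s) + \sum_j - 1 * (4 * S i j) +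
    (- 2 * 1 * (2 * s) + \sum_j - 2 * - 1 * (2 * S i j))) <=
   1 * expR (4 * s) + \sum_j - 1 * expR (4 * S i j) +
    (- 2 * 1 * expR (2 * s) + \sum_j - 2 * - 1 * expR (2 * S i j)).
  apply: h => k k1; rewrite E/=.
  rewrite [leRHS](_ : _ = (4 ^+ k - 2 * 2 ^+ k) * (s ^+ k - \sum_j S i j ^+ k)).
    rewrite mulr_ge0// subr_ge0.
      rewrite -exprS [leRHS](_ : _ = 2 ^+ (2 * k)); last first.
        by rewrite exprM; congr (_ ^+ _); ring.
      by rewrite ler_eXn2l ?ltr1n//; lia.
    apply: le_trans (row_power_le i k1); apply: ler_sum => j _.
    by rewrite -normrX ler_norm.
  rewrite mulrBr !mulr_sumr.
  under [in LHS]eq_bigr do rewrite exprMn.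
  under [X in _ + (_ + X)]eq_bigr do rewrite exprMn.
  rewrite !exprMn addrACA -big_split/=; congr (_ + _); first by ring.
  by rewrite -sumrN; apply: eq_bigr => j _; ring.
have sq (x : R) : (expR (2 * x) - 1) ^+ 2 = expR (4 * x) - 2 * expR (2 * x) + 1.
  rewrite sqrrB1 -expRM_natl mulrA (_ : 2%:R * 2 = 4 :> R); last by ring.
  by rewrite -mulr_natl; ring.
under [X in _ -> X <= _]eq_bigr do rewrite sq.
rewrite sq big_split/= sumrB -!mulr_sumr.
(* The terms of order zero and one cancel, up to the number of entries. *)
have c1 : \sum_(j < p) (- 1) = - p%:R :> R by rewrite sumr_const card_ord mulNrn.
have c2 : \sum_(j < p) 1 = p%:R :> R by rewrite sumr_const card_ord.
rewrite c1 c2; lra.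
Qed.

End covariance_series.

(** * Moments of a log-normal vector *)

Section lognormal_moments.
Context {R : realType} {d : measure_display} {T : measurableType d}
  {P : probability T R} {p : nat} (Z : 'I_p -> {RV P >-> R})
  (mu : 'cV[R]_p) (Sigma : 'M[R]_p).
Hypothesis hZ : gaussian_with Z mu Sigma.
Local Notation lin := (lin_form Z mu).
Local Notation N := (abs_coord_sum Z mu).
Let gN := gauge_abs_coord_sum hZ.
Local Notation s := (opnorm Sigma).
Local Notation e i := (delta_mx i 0 : 'cV[R]_p).

Lemma lin_form_delta i w : lin (e i) w = Z i w - mu i 0.
Proof.
rewrite /lin_form (bigD1 i)//= big1 => [|j ji]; first by rewrite mxE !eqxx mul1r addr0.
by rewrite mxE (negbTE ji) mul0r.
Qed.

Lemma cov_form_delta i j : cov_form Sigma (e i) (e j) = Sigma i j.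
Proof. by rewrite /cov_form trmx_delta -rowE -colE !mxE. Qed.

Lemma cov_sym i j : Sigma i j = Sigma j i.
Proof.
rewrite -!(coord_covariance hZ); apply: eq_Rintegral => w _.
by rewrite mulrC.
Qed.

Lemma tame_exp_sum (I : finType) (c : I -> R) (k : I -> 'I_p) :
  tame N (fun w => expR (\sum_i c i * Z (k i) w)).
Proof.
apply: tame_expR; apply: (lin_growth_sum gN) => i; apply: (lin_growthZ gN).
have := lin_growthD (lin_growth_coord Z mu (k i)) (lin_growth_cst gN (mu (k i) 0)).
rewrite (_ : _ \+ _ = Z (k i))//.
by apply/funext => w /=; rewrite subrK.
Qed.

(** The exponent is, up to its mean, a linear form of the centered vector. *)
Lemma exp_sum_mean (I : finType) (c : I -> R) (k : I -> 'I_p) :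
  \int[P]_w expR (\sum_i c i * Z (k i) w) =
  expR (\sum_i c i * mu (k i) 0 +
        (\sum_i \sum_j c i * c j * Sigma (k i) (k j)) / 2).
Proof.
pose a := \sum_i c i *: e (k i).
have q : quad_form Sigma a = \sum_i \sum_j c i * c j * Sigma (k i) (k j).
  rewrite quad_form_sum; apply: eq_bigr => i _; apply: eq_bigr => j _.
  by rewrite cov_form_delta.
rewrite -q expRD -(lin_form_mgf hZ) -(tame_RintegralZ gN); last first.
  by apply: tame_expR; exact: (lin_growth_lin_form hZ).
apply: eq_Rintegral => w _; rewrite -expRD; congr expR.
rewrite lin_form_sum -big_split/=; apply: eq_bigr => i _.
by rewrite lin_form_delta mulrBr subrKC.
Qed.

Local Notation Y i w := (expR (Z i w)).

Lemma tame_lognormal i : tame N (fun w => Y i w).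
Proof.
have := tame_exp_sum (fun _ : 'I_1 => 1) (fun=> i).
by under eq_fun do rewrite big_ord1 mul1r.
Qed.

Lemma lognormal_moment i n :
  \int[P]_w Y i w ^+ n = expR (n%:R * mu i 0 + n%:R ^+ 2 * Sigma i i / 2).
Proof.
have := exp_sum_mean (fun _ : 'I_1 => n%:R) (fun=> i).
rewrite !big_ord1 -expr2 => <-; apply: eq_Rintegral => w _.
by rewrite big_ord1 expRM_natl.
Qed.

Definition lognormal_mean i : R := expR (mu i 0 + Sigma i i / 2).
Local Notation m := lognormal_mean.

Lemma lognormal_meanE i : \int[P]_w Y i w = m i.
Proof.
rewrite /lognormal_mean; have := lognormal_moment i 1; rewrite expr1n !mul1r => <-.
by apply: eq_Rintegral => w _; rewrite expr1.
Qed.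

Let D i : R := expR (2 * mu i 0 + 2 * Sigma i i).

Lemma lognormal_moment2 i : \int[P]_w Y i w ^+ 2 = D i.
Proof. by rewrite lognormal_moment; congr expR; field. Qed.

Lemma lognormal_moment12 i j :
  \int[P]_w (Y j w * Y i w ^+ 2) = D i * m j * expR (2 * Sigma i j).
Proof.
pose c (k : 'I_2) : R := nth 0 [:: 1; 2] k.
pose x (k : 'I_2) := nth i [:: j; i] k.
transitivity (\int[P]_w expR (\sum_k c k * Z (x k) w)).
  apply: eq_Rintegral => w _; rewrite !big_ord_recl big_ord0 /c /x/= addr0 mul1r.
  by rewrite -expRM_natl -expRD.
rewrite exp_sum_mean !big_ord_recl !big_ord0 /c /x/= /D /lognormal_mean -!expRD.
rewrite (cov_sym j i).
by congr expR; field.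
Qed.

Lemma lognormal_moment112 i j k :
  \int[P]_w (Y j w * Y k w * Y i w ^+ 2) =
  D i * m j * m k * expR (2 * Sigma i j) * expR (2 * Sigma i k) * expR (Sigma j k).
Proof.
pose c (k : 'I_3) : R := nth 0 [:: 1; 1; 2] k.
pose x (l : 'I_3) := nth i [:: j; k; i] l.
transitivity (\int[P]_w expR (\sum_k c k * Z (x k) w)).
  apply: eq_Rintegral => w _; rewrite !big_ord_recl big_ord0 /c /x/= addr0 !mul1r.
  by rewrite -expRM_natl -!expRD addrA.
rewrite exp_sum_mean !big_ord_recl !big_ord0 /c /x/= /D /lognormal_mean -!expRD.
rewrite (cov_sym j i) (cov_sym k i) (cov_sym k j).
by congr expR; field.
Qed.

(** Weighting by [Y_i ^ 2] amounts to shifting the Gaussian vector, which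
multiplies each [Y_j] by [expR (2 * Sigma i j)]; the second moment for the
shifted law is a variance plus a squared mean. *)
Lemma weighted_second_moment i (u : 'I_p -> R) :
  \int[P]_w ((\sum_j u j * (Y j w - m j)) ^+ 2 * Y i w ^+ 2) =
  D i * (\sum_j \sum_k (u j * m j * expR (2 * Sigma i j)) *
           (u k * m k * expR (2 * Sigma i k)) * (expR (Sigma j k) - 1) +
         (\sum_j u j * m j * (expR (2 * Sigma i j) - 1)) ^+ 2).
Proof.
have tY := tame_lognormal.
have t2 := tameX gN 2 (tY i).
have t12 j := tameM (tY j) t2.
have t112 j k := tameM (tameM (tY j) (tY k)) t2.
transitivity (\int[P]_w (\sum_j \sum_k u j * u k *
    (Y j w * Y k w * Y i w ^+ 2 + (m j * m k * Y i w ^+ 2 -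
     (m k * (Y j w * Y i w ^+ 2) + m j * (Y k w * Y i w ^+ 2)))))).
  apply: eq_Rintegral => w _; rewrite expr2 !mulr_suml; apply: eq_bigr => j _.
  rewrite -mulrA mulr_suml mulr_sumr; apply: eq_bigr => k _; ring.
have tb j k := tameD gN (tameZ gN (m k) (t12 j)) (tameZ gN (m j) (t12 k)).
have ta j k := tameB gN (tameZ gN (m j * m k) t2) (tb j k).
have tf j k := tameD gN (t112 j k) (ta j k).
have tg j k := tameZ gN (u j * u k) (tf j k).
rewrite (tame_Rintegral_sum gN); last by move=> j; apply: (tame_sum gN) => k; exact: tg.
transitivity (\sum_j \sum_k u j * u k * (D i * (m j * m k) *
  (expR (2 * Sigma i j) * expR (2 * Sigma i k) * expR (Sigma j k) + 1
   - expR (2 * Sigma i j) - expR (2 * Sigma i k)))).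
  apply: eq_bigr => j _; rewrite (tame_Rintegral_sum gN); last by move=> k; exact: tg.
  apply: eq_bigr => k _; rewrite (tame_RintegralZ gN _ (tf j k)); congr (_ * _).
  rewrite (tame_RintegralD gN (t112 j k) (ta j k)).
  rewrite (tame_RintegralB gN (tameZ gN (m j * m k) t2) (tb j k)).
  rewrite (tame_RintegralD gN (tameZ gN (m k) (t12 j)) (tameZ gN (m j) (t12 k))).
  rewrite (tame_RintegralZ gN _ t2).
  rewrite (tame_RintegralZ gN _ (t12 j)) (tame_RintegralZ gN _ (t12 k)).
  rewrite lognormal_moment112 !lognormal_moment12 lognormal_moment2.
  ring.
rewrite expr2 mulr_suml -big_split mulr_sumr; apply: eq_bigr => j _.
rewrite mulr_sumr -big_split mulr_sumr; apply: eq_bigr => k _ /=.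
ring.
Qed.

Hypothesis p_gt0 : (0 < p)%N.
Let s0 : 0 <= s := opnorm_ge0 Sigma p_gt0.

Lemma mean_coord_le i : mu i 0 <= norm2 mu.
Proof. exact: le_trans (ler_norm _) (norm2_coord mu i). Qed.

Lemma var_coord_le i : Sigma i i <= s.
Proof. exact: le_trans (ler_norm _) (entry_le Sigma i i). Qed.

(** Let [t = expR s], and let [M = expR (norm2 mu + s / 2)], a bound on all means.
The variance is at most [(t - 1) t ^ 4] and the squared mean at most
[(t ^ 2 - 1) ^ 2], both up to the factor [M ^ 2], and
[(t - 1) t ^ 4 + (t ^ 2 - 1) ^ 2 <= t ^ 5]. *)
Lemma weighted_second_moment_le i (u : 'I_p -> R) : \sum_j u j ^+ 2 <= 1 ->
  \int[P]_w ((\sum_j u j * (Y j w - m j)) ^+ 2 * Y i w ^+ 2) <=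
  expR (4 * norm2 mu + 8 * s).
Proof.
move=> u1; rewrite weighted_second_moment.
pose M := expR (norm2 mu + s / 2).
have mM j : m j ^+ 2 <= M ^+ 2.
  rewrite lerXn2r ?nnegrE ?expR_ge0// ler_expR.
  by have := mean_coord_le j; have := var_coord_le j; lra.
have umM : \sum_j (u j * m j) ^+ 2 <= M ^+ 2.
  apply: (@le_trans _ _ (\sum_j u j ^+ 2 * M ^+ 2)).
    by apply: ler_sum => j _; rewrite exprMn ler_wpM2l ?sqr_ge0.
  by rewrite -mulr_suml ler_piMl ?sqr_ge0.
have DM : D i <= expR (2 * norm2 mu + 2 * s).
  by rewrite ler_expR; have := mean_coord_le i; have := var_coord_le i; lra.
set t := expR s.
have t1 : 1 <= t by rewrite -[leLHS]expR0 ler_expR.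
have t2 : expR (2 * s) = t ^+ 2 by rewrite expRM_natl.
have part1 : \sum_j \sum_k (u j * m j * expR (2 * Sigma i j)) *
           (u k * m k * expR (2 * Sigma i k)) * (expR (Sigma j k) - 1) <=
    (t - 1) * (M ^+ 2 * t ^+ 4).
  apply: (le_trans (exp_covariance_le cov_sym p_gt0
    (fun j => u j * m j * expR (2 * Sigma i j)))).
  rewrite ler_wpM2l ?subr_ge0//.
  apply: (@le_trans _ _ (\sum_j (u j * m j) ^+ 2 * t ^+ 4)); last first.
    by rewrite -mulr_suml ler_wpM2r// exprn_ge0// expR_ge0.
  apply: ler_sum => j _; rewrite exprMn ler_wpM2l ?sqr_ge0//.
  rewrite (exprM t 2 2) -t2 lerXn2r ?nnegrE ?expR_ge0// ler_expR ler_wpM2l//.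
  exact: le_trans (ler_norm _) (entry_le Sigma i j).
have part2 : (\sum_j u j * m j * (expR (2 * Sigma i j) - 1)) ^+ 2 <=
    M ^+ 2 * (t ^+ 2 - 1) ^+ 2.
  apply: (le_trans (cauchy_schwarz _ _)); rewrite ler_pM//.
  - by apply: sumr_ge0 => j _; exact: sqr_ge0.
  - by apply: sumr_ge0 => j _; exact: sqr_ge0.
  - by rewrite -t2; exact: exp_row_le cov_sym p_gt0 i.
have -> : expR (4 * norm2 mu + 8 * s) =
    expR (2 * norm2 mu + 2 * s) * (M ^+ 2 * t ^+ 5).
  by rewrite /M /t -!expRM_natl -!expRD; congr expR; field.
have M0 : 0 <= M ^+ 2 by exact: sqr_ge0.
apply: (@le_trans _ _ (D i * (M ^+ 2 * t ^+ 5))).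
  rewrite ler_wpM2l ?expR_ge0//; apply: (le_trans (lerD part1 part2)).
  rewrite mulrCA -mulrDr ler_wpM2l//.
  have : 0 <= t ^+ 2 by rewrite sqr_ge0.
  rewrite -subr_ge0; have -> : t ^+ 5 - ((t - 1) * t ^+ 4 + (t ^+ 2 - 1) ^+ 2)
    = 2 * t ^+ 2 - 1 by ring.
  nra.
by rewrite ler_wpM2r// mulr_ge0// exprn_ge0// expR_ge0.
Qed.

End lognormal_moments.

(** * Linear and quadratic forms of a centered log-normal vector *)

Section lognormal_concentration.
Context {R : realType} {d : measure_display} {T : measurableType d}
  {P : probability T R} {p : nat} (Z : 'I_p -> {RV P >-> R})
  (mu : 'cV[R]_p) (Sigma : 'M[R]_p).
Hypothesis hZ : gaussian_with Z mu Sigma.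
Hypothesis p_gt0 : (0 < p)%N.
Local Notation lin := (lin_form Z mu).
Local Notation N := (abs_coord_sum Z mu).
Let gN := gauge_abs_coord_sum hZ.
Local Notation s := (opnorm Sigma).
Local Notation e i := (delta_mx i 0 : 'cV[R]_p).
Local Notation Y i w := (expR (Z i w)).
Local Notation m := (lognormal_mean mu Sigma).
Local Notation gamma := (@normal_prob R 0 1).
Let s0 : 0 <= s := opnorm_ge0 Sigma p_gt0.

Lemma centered_lognormalE w i :
  centered P (lognormal Z) w i 0 = Y i w - m i.
Proof.
rewrite /centered /lognormal /mean_vec !mxE unlock; congr (_ - _).
rewrite -(lognormal_meanE hZ) /Rintegral; congr fine.
by apply: eq_integral => w' _; rewrite mxE.
Qed.

Lemma expR_mean_lin i w : expR (mu i 0) * expR (lin (e i) w) = Y i w.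
Proof. by rewrite -expRD lin_form_delta subrKC. Qed.

Lemma gauss_abs_moment_ge0 n : 0 <= \int[gamma]_x `|x| ^+ n.
Proof. by apply: Rintegral_ge0 => x _; rewrite exprn_ge0. Qed.

Lemma pisier_opnorm (J : finType) (c : J -> R) (a : J -> 'cV[R]_p) (r : nat) :
  (0 < r)%N ->
  \int[P]_w (exp_poly Z mu c a w - \int[P]_w' exp_poly Z mu c a w') ^+ (2 * r) <=
  (pi / 2) ^+ (2 * r) * \int[gamma]_x (`|x| ^+ (2 * r)) *
  (s ^+ r * \int[P]_w (norm2 (exp_grad Z mu c a w) ^+ 2) ^+ r).
Proof.
move=> r0; apply: (le_trans (pisier hZ c a r0)).
rewrite ler_wpM2l//.
  by rewrite mulr_ge0 ?gauss_abs_moment_ge0// exprn_ge0// divr_ge0// pi_ge0.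
have tn : tame N (fun w => norm2 (exp_grad Z mu c a w) ^+ 2).
  under eq_fun do rewrite norm2_sqr.
  apply: (tame_sum gN) => i; apply: (tameX gN).
  under eq_fun do rewrite summxE.
  apply: (tame_sum gN) => j.
  under eq_fun do rewrite mxE.
  apply: (tameM (N := N)); last exact: (tame_cst gN).
  by apply: (tameZ gN); apply: tame_expR; exact: (lin_growth_lin_form hZ).
have tnr := tameX gN r tn.
rewrite -(tame_RintegralZ gN _ tnr); apply: (tame_le_Rintegral gN).
- exact: (tameX gN r (tame_quad_grad hZ c a)).
- exact: (tameZ gN).
- move=> w; rewrite -exprMn lerXn2r ?nnegrE ?mulr_ge0 ?norm2_ge0//.
    exact: (quad_form_cov_ge0 hZ).
  exact: quad_form_le.
Qed.

(** Here the gradient has coordinates [v_i Y_i]; since the [v_i ^ 2] are weights of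
sum one, Jensen's inequality reduces the power of its squared norm to the
moments of order [2 r] of the [Y_i]. *)
Lemma linear_moment_le (v : 'cV[R]_p) (r : nat) : (0 < r)%N -> norm2 v = 1 ->
  \int[P]_w (\sum_i v i 0 * (Y i w - m i)) ^+ (2 * r) <=
  \int[gamma]_x (`|x| ^+ (2 * r)) * ((pi / 2) ^+ (2 * r) * s ^+ r *
    expR ((2 * r)%:R * norm2 mu + (2 * r)%:R ^+ 2 * s / 2)).
Proof.
move=> r0 v1.
pose c i := v i 0 * expR (mu i 0).
have tY i : tame N (fun w => Y i w) by exact: (tame_lognormal hZ).
have fE w : exp_poly Z mu c (fun i => e i) w = \sum_i v i 0 * Y i w.
  by apply: eq_bigr => i _; rewrite -mulrA expR_mean_lin.
have EfE : \int[P]_w exp_poly Z mu c (fun i => e i) w = \sum_i v i 0 * m i.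
  under eq_Rintegral do rewrite fE.
  rewrite (tame_Rintegral_sum gN); last by move=> i; apply: (tameZ gN).
  by apply: eq_bigr => i _; rewrite (tame_RintegralZ gN)// (lognormal_meanE hZ).
have gE w : norm2 (exp_grad Z mu c (fun i => e i) w) ^+ 2 =
    \sum_i v i 0 ^+ 2 * Y i w ^+ 2.
  rewrite norm2_sqr; apply: eq_bigr => i _; rewrite summxE (bigD1 i)//= big1.
    by rewrite !mxE !eqxx mulr1 addr0 -mulrA expR_mean_lin exprMn.
  by move=> j ji; rewrite !mxE eq_sym (negbTE ji) mulr0.
have := pisier_opnorm c (fun i => e i) r0.
under eq_Rintegral do rewrite EfE fE -sumrB.
under eq_Rintegral do under eq_bigr do rewrite -mulrBr.
move=> /le_trans; apply.
rewrite -mulrA mulrCA ler_wpM2l ?gauss_abs_moment_ge0// -mulrA.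
have pi0 : 0 <= pi / 2 :> R by rewrite divr_ge0// pi_ge0.
rewrite ler_wpM2l ?exprn_ge0// ler_wpM2l ?exprn_ge0//.
under eq_Rintegral do rewrite gE.
have tr i : tame N (fun w => v i 0 ^+ 2 * (Y i w ^+ 2) ^+ r).
  by apply: (tameZ gN); do 2 apply: (tameX gN).
apply: (@le_trans _ _ (\int[P]_w \sum_i v i 0 ^+ 2 * (Y i w ^+ 2) ^+ r)).
  apply: (tame_le_Rintegral gN).
  - apply: (tameX gN); apply: (tame_sum gN) => i; apply: (tameZ gN).
    exact: (tameX gN).
  - by apply: (tame_sum gN) => i.
  - move=> w; case: r r0 {tr} => // r _; apply: jensen_exprn.
    + by move=> i; exact: sqr_ge0.
    + by rewrite -norm2_sqr v1 expr1n.
    + by move=> i; exact: sqr_ge0.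
rewrite (tame_Rintegral_sum gN)//.
set E := expR _.
apply: (@le_trans _ _ (\sum_i v i 0 ^+ 2 * E)); last first.
  by rewrite -mulr_suml -norm2_sqr v1 expr1n mul1r.
apply: ler_sum => i _; rewrite (tame_RintegralZ gN); last by do 2 apply: (tameX gN).
rewrite ler_wpM2l ?sqr_ge0//.
under eq_Rintegral do rewrite -exprM.
rewrite (lognormal_moment hZ) ler_expR lerD//.
  by rewrite ler_wpM2l// mean_coord_le.
by rewrite ler_wpM2r ?invr_ge0// ler_wpM2l ?sqr_ge0// var_coord_le.
Qed.

Lemma quad_formE (M : 'M[R]_p) (x : 'cV[R]_p) :
  quad_form M x = \sum_i \sum_j M i j * (x i 0 * x j 0).
Proof.
rewrite /quad_form mxE exchange_big/=; apply: eq_bigr => j _.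
rewrite !mxE mulr_suml; apply: eq_bigr => i _.
by rewrite !mxE; ring.
Qed.

(** Up to an additive constant the quadratic form is a combination of exponentials
of linear forms, with gradient [2 Y_i (M X)_i]. The rows of [M] have Euclidean
norm at most one, so [weighted_second_moment_le] bounds the second moment of
each coordinate. *)
Lemma quadratic_variance_le (M : 'M[R]_p) : psd M -> opnorm M <= 1 ->
  let q w := quad_form M (centered P (lognormal Z) w) in
  tame N q /\
  \int[P]_w (q w - \int[P]_w' q w') ^+ 2 <=
  pi ^+ 2 * \int[gamma]_x (`|x| ^+ 2) *
    (s * p%:R * expR (4 * norm2 mu + 8 * s)).
Proof.
move=> [Msym _] M1 q.
have MS i j : M i j = M j i by rewrite -{1}Msym mxE.
pose J := (('I_p * 'I_p) + 'I_p)%type.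
(* [b = M m], and the indices of [J] stand for the products [Y_i Y_j] and for the
   linear terms of the expanded quadratic form. *)
pose b i := \sum_j M i j * m j.
pose c (j : J) : R := match j with
  | inl ij => M ij.1 ij.2 * (expR (mu ij.1 0) * expR (mu ij.2 0))
  | inr i => - 2 * b i * expR (mu i 0) end.
pose a (j : J) : 'cV[R]_p := match j with
  | inl ij => e ij.1 + e ij.2 | inr i => e i end.
have tY i : tame N (fun w => Y i w) by exact: (tame_lognormal hZ).
pose f := exp_poly Z mu c a.
pose k0 := \sum_i m i * b i.
have linD (x y : 'cV[R]_p) w : lin (x + y) w = lin x w + lin y w.
  by rewrite /lin_form -big_split/=; apply: eq_bigr => i _; rewrite mxE mulrDl.
have fE w : f w = \sum_i \sum_j M i j * (Y i w * Y j w) - 2 * \sum_i b i * Y i w.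
  rewrite /f /exp_poly big_sumType/= pair_bigA/=; congr (_ + _).
    apply: eq_bigr => -[i j] _ /=; rewrite linD expRD.
    by rewrite -!expR_mean_lin; ring.
  rewrite mulr_sumr -sumrN; apply: eq_bigr => i _; rewrite -expR_mean_lin; ring.
have qE w : q w = f w + k0.
  rewrite fE /q quad_formE /k0 mulr_sumr -sumrN -!big_split/=.
  have sw : \sum_i \sum_j M i j * (m i * Y j w) = \sum_i b i * Y i w.
    rewrite exchange_big/=; apply: eq_bigr => j _; rewrite mulr_suml.
    by apply: eq_bigr => i _; rewrite MS mulrA.
  transitivity (\sum_i (\sum_j M i j * (Y i w * Y j w) - b i * Y i w + m i * b i)
      - \sum_i \sum_j M i j * (m i * Y j w)).
    rewrite -sumrB; apply: eq_bigr => i _; rewrite /b mulr_suml mulr_sumr.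
    rewrite -sumrB -big_split/= -sumrB; apply: eq_bigr => j _.
    by rewrite !centered_lognormalE; ring.
  by rewrite sw -sumrB; apply: eq_bigr => i _; ring.
have tf : tame N f by exact: (tame_exp_poly hZ).
have tk := tame_cst gN k0.
have tq : tame N q.
  by rewrite (_ : q = fun w => f w + k0); [exact: (tameD gN tf tk)|exact/funext].
split => //.
have Eq : \int[P]_w q w = \int[P]_w f w + k0.
  under eq_Rintegral do rewrite qE.
  by rewrite (tame_RintegralD gN tf tk) Rintegral_prob_cst.
have del (F : 'I_p -> R) i : \sum_j F j * (i == j)%:R = F i.
  rewrite (bigD1 i)//= eqxx mulr1 big1 ?addr0// => j ji.
  by rewrite eq_sym (negbTE ji) mulr0.
have gradE w i : exp_grad Z mu c a w i 0 = 2 * Y i w * \sum_j M i j * (Y j w - m j).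
  rewrite summxE big_sumType/=.
  have -> : \sum_(ij : 'I_p * 'I_p) (c (inl ij) * expR (lin (a (inl ij)) w) *:
      a (inl ij)) i 0 = 2 * Y i w * \sum_j M i j * Y j w.
    transitivity (\sum_j \sum_k (M j k * (Y j w * Y k w) * (i == j)%:R +
        M j k * (Y j w * Y k w) * (i == k)%:R)).
      rewrite pair_bigA; apply: eq_bigr => -[j k] _ /=.
      rewrite !mxE !eqxx !andbT linD expRD -!expR_mean_lin; ring.
    under eq_bigr do rewrite big_split/=.
    rewrite big_split/= exchange_big/=.
    under eq_bigr do rewrite del.
    under [X in _ + X]eq_bigr do rewrite del.
    rewrite -big_split mulr_sumr; apply: eq_bigr => j _ /=.
    by rewrite (MS j i); ring.
  have -> : \sum_j (c (inr j) * expR (lin (a (inr j)) w) *: a (inr j)) i 0 =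
      - 2 * b i * Y i w.
    transitivity (\sum_j (- 2 * b j * Y j w) * (i == j)%:R); last by rewrite del.
    apply: eq_bigr => j _ /=; rewrite !mxE eqxx andbT -expR_mean_lin; ring.
  have -> : \sum_j M i j * (Y j w - m j) = \sum_j M i j * Y j w - b i.
    by rewrite -sumrB; apply: eq_bigr => j _; rewrite mulrBr.
  ring.
have gE w : norm2 (exp_grad Z mu c a w) ^+ 2 =
    \sum_i 4 * ((\sum_j M i j * (Y j w - m j)) ^+ 2 * Y i w ^+ 2).
  by rewrite norm2_sqr; apply: eq_bigr => i _; rewrite gradE; ring.
have := pisier_opnorm c a (isT : (0 < 1)%N).
rewrite muln1 !expr1.
have -> : \int[P]_w (q w - \int[P]_w' q w') ^+ 2 =
    \int[P]_w (exp_poly Z mu c a w - \int[P]_w' exp_poly Z mu c a w') ^+ 2.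
  by apply: eq_Rintegral => w _; rewrite Eq qE /f; congr (_ ^+ 2); ring.
move=> /le_trans; apply.
have -> : \int[P]_w (norm2 (exp_grad Z mu c a w) ^+ 2) ^+ 1 =
    \int[P]_w \sum_i 4 * ((\sum_j M i j * (Y j w - m j)) ^+ 2 * Y i w ^+ 2).
  by apply: eq_Rintegral => w _; rewrite expr1 gE.
have ti i : tame N (fun w => (\sum_j M i j * (Y j w - m j)) ^+ 2 * Y i w ^+ 2).
  apply: (tameM (N := N)); last exact: (tameX gN).
  apply: (tameX gN); apply: (tame_sum gN) => j; apply: (tameZ gN).
  by apply: (tameB gN) => //; exact: (tame_cst gN).
rewrite (tame_Rintegral_sum gN); last by move=> i; exact: (tameZ gN).
set K := \int[gamma]_x _.
have K0 : 0 <= K by exact: gauss_abs_moment_ge0.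
have : \sum_i \int[P]_w (4 * ((\sum_j M i j * (Y j w - m j)) ^+ 2 * Y i w ^+ 2)) <=
    4 * (p%:R * expR (4 * norm2 mu + 8 * s)).
  have -> (B : R) : p%:R * B = \sum_(i < p) B by rewrite sumr_const card_ord mulr_natl.
  rewrite mulr_sumr.
  apply: ler_sum => i _; rewrite (tame_RintegralZ gN _ (ti i)) ler_wpM2l//.
  apply: (weighted_second_moment_le hZ p_gt0).
  under eq_bigr do rewrite MS; apply: (le_trans (col_sqr_le M i)).
  by rewrite expr_le1 ?opnorm_ge0.
move=> /(ler_wpM2l (mulr_ge0 (mulr_ge0 (sqr_ge0 (pi / 2)) K0) s0)).
rewrite -[in X in X -> _]mulrA => /le_trans; apply.
rewrite le_eqVlt; apply/orP; left; apply/eqP; by field.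
Qed.

End lognormal_concentration.

Section moment_bounds.
Context {R : realType} {d : measure_display} {T : measurableType d}
  {P : probability T R} {p : nat} (Z : 'I_p -> {RV P >-> R})
  (mu : 'cV[R]_p) (Sigma : 'M[R]_p).
Hypothesis hZ : gaussian_with Z mu Sigma.
Hypothesis p_gt0 : (0 < p)%N.
Local Notation N := (abs_coord_sum Z mu).
Let gN := gauge_abs_coord_sum hZ.
Local Notation s := (opnorm Sigma).
Local Notation K n := (\int[@normal_prob R 0 1]_x (`|x| ^+ n)).

Lemma normr_even (x : R) r : `|x| ^+ (2 * r) = x ^+ (2 * r).
Proof. by rewrite !exprM real_normK// num_real. Qed.

Lemma b_L_le r : (0 < r)%N ->
  (b_L P (2 * r) (centered P (lognormal Z)) <=
   (K (2 * r) * ((pi / 2) ^+ (2 * r) * s ^+ r *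
    expR ((2 * r)%:R * norm2 mu + (2 * r)%:R ^+ 2 * s / 2)))%:E)%E.
Proof.
move=> r0; apply: ge_ereal_sup => _ [v /= v1 <-].
rewrite unlock.
have tY i : tame N (fun w => expR (Z i w) - lognormal_mean mu Sigma i).
  by apply: (tameB gN); [exact: (tame_lognormal hZ)|exact: (tame_cst gN)].
have tv : tame N (fun w =>
    (\sum_i v i 0 * (expR (Z i w) - lognormal_mean mu Sigma i)) ^+ (2 * r)).
  by apply: (tameX gN); apply: (tame_sum gN) => i; apply: (tameZ gN).
under eq_integral => w _.
  rewrite normr_even mxE.
  under eq_bigr do rewrite mxE (centered_lognormalE hZ) mulrC.
  over.
by rewrite (tame_integralE gN tv) lee_fin; exact: linear_moment_le.
Qed.

Lemma b_Q2_le :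
  (b_Q2 P 2 (centered P (lognormal Z)) <=
   (pi ^+ 2 * K 2 * (s * p%:R * expR (4 * norm2 mu + 8 * s)))%:E)%E.
Proof.
apply: ge_ereal_sup => _ [M /= [Mpsd M1] <-].
have [tq var_le] := quadratic_variance_le hZ p_gt0 Mpsd M1.
rewrite unlock (tame_integralE gN tq)/=.
have tq2 := tameX gN 2 (tameB gN tq (tame_cst gN
  (\int[P]_w quad_form M (centered P (lognormal Z) w)))).
under eq_integral do rewrite -normrX ger0_norm ?sqr_ge0//.
by rewrite (tame_integralE gN tq2) lee_fin.
Qed.

End moment_bounds.

Theorem mainTheorem13 (R : realType) :
  (forall (d : measure_display) (T : measurableType d) (P : probability T R)
      (p : nat) (hp : (0 < p)%N) (Z : 'I_p -> {RV P >-> R})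
      (mu : 'cV[R]_p) (Sigma : 'M[R]_p) (hZ : gaussian_with Z mu Sigma),
    let X := centered P (lognormal Z) in
    let mus := norm2 mu in
    let sigmas := Num.sqrt (opnorm Sigma) in
    (forall (r : nat), (1 <= r)%N ->
      (b_L P (2 * r) X <=
        gauss_moment R (2 * r) *
        ((pi / 2) ^+ (2 * r) * sigmas ^+ (2 * r) *
         expR ((2 * r)%:R * mus + ((2 * r)%:R * sigmas) ^+ 2 / 2))%:E)%E) /\
    (b_Q2 P 2 X <=
      (4 * pi ^+ 2)%:E * gauss_moment R 2 *
      (sigmas ^+ 2 * p%:R * expR (4 * mus + 8 * sigmas ^+ 2))%:E)%E)
  /\
  (forall B : R,
    (forall r : nat, (1 <= r)%N -> exists C : R,
      forall (d : measure_display) (T : measurableType d) (P : probability T R)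
        (p : nat) (hp : (0 < p)%N) (Z : 'I_p -> {RV P >-> R})
        (mu : 'cV[R]_p) (Sigma : 'M[R]_p) (hZ : gaussian_with Z mu Sigma),
      norm2 mu <= B -> opnorm Sigma <= B ->
      (b_L P (2 * r) (centered P (lognormal Z)) <= C%:E)%E) /\
    (exists C : R,
      forall (d : measure_display) (T : measurableType d) (P : probability T R)
        (p : nat) (hp : (0 < p)%N) (Z : 'I_p -> {RV P >-> R})
        (mu : 'cV[R]_p) (Sigma : 'M[R]_p) (hZ : gaussian_with Z mu Sigma),
      norm2 mu <= B -> opnorm Sigma <= B ->
      (b_Q2 P 2 (centered P (lognormal Z)) <= (C * p%:R)%:E)%E)).
Proof.
split.
  move=> d T P p hp Z mu Sigma hZ X mus sigmas.
  have ss : sigmas ^+ 2 = opnorm Sigma by rewrite sqr_sqrtr// opnorm_ge0.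
  split=> [r r1|].
    rewrite gauss_momentE -EFinM [(_ * sigmas) ^+ 2]exprMn (exprM sigmas) ss.
    exact: b_L_le.
  rewrite gauss_momentE -!EFinM ss; apply: (le_trans (b_Q2_le hZ hp)).
  rewrite lee_fin -!mulrA -[leLHS]mul1r ler_wpM2r//; last by lra.
  by rewrite !mulr_ge0 ?pi_ge0 ?gauss_abs_moment_ge0 ?expR_ge0 ?opnorm_ge0//.
move=> B.
have K0 n := @gauss_abs_moment_ge0 R n.
split=> [r r1|].
  exists (\int[@normal_prob R 0 1]_x (`|x| ^+ (2 * r)) *
    ((pi / 2) ^+ (2 * r) * B ^+ r *
     expR ((2 * r)%:R * B + (2 * r)%:R ^+ 2 * B / 2))).
  move=> d T P p hp Z mu Sigma hZ muB sB.
  apply: (le_trans (b_L_le hZ hp r1)); rewrite lee_fin ler_wpM2l//.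
  have s0 := opnorm_ge0 Sigma hp.
  have pi0 : 0 <= pi / 2 :> R by rewrite divr_ge0// pi_ge0.
  rewrite ler_pM ?mulr_ge0 ?exprn_ge0 ?expR_ge0//.
    by rewrite ler_wpM2l ?exprn_ge0// lerXn2r ?nnegrE// (le_trans s0).
  rewrite ler_expR lerD// ?ler_wpM2l//.
  by rewrite ler_wpM2r ?invr_ge0// ler_wpM2l ?sqr_ge0.
exists (pi ^+ 2 * \int[@normal_prob R 0 1]_x (`|x| ^+ 2) *
  (B * expR (4 * B + 8 * B))).
move=> d T P p hp Z mu Sigma hZ muB sB.
apply: (le_trans (b_Q2_le hZ hp)); rewrite lee_fin -[leRHS]mulrA.
have s0 := opnorm_ge0 Sigma hp.
rewrite ler_wpM2l ?mulr_ge0 ?pi_ge0//.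
rewrite mulrAC ler_wpM2r// ler_pM ?expR_ge0//.
by rewrite ler_expR; lra.
Qed.
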